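(* Let $(M,g)$ be a Riemannian manifold with Levi-Civita connection $\nabla$ and let $T(M)$ be its tangent bundle equipped with the metric $g_A$ described in the context. Then the Levi-Civita connection $\tilde\nabla^A$ of $g_A$ satisfies, for all vector fields $X,Y$ on $M$ and at every point $(p,\mathtt{u})\in T(M)$, $$\tilde\nabla^A_{X^H}Y^H=(\nabla_XY)^H-\tfrac12(R_{XY}\mathtt{u})^V,$$ $$\tilde\nabla^A_{X^H}Y^V=(\nabla_XY)^V+\tfrac a2(R_{\mathtt{u}Y}X)^H,$$ $$\tilde\nabla^A_{X^V}Y^H=\tfrac a2(R_{\mathtt{u}X}Y)^H,$$ $$\tilde\nabla^A_{X^V}Y^V=\mathtt{L}\left(g(X,\mathtt{u})Y^V+g(Y,\mathtt{u})X^V\right)+\mathtt{M}\,g(X,Y)\mathtt{u}^V+\mathtt{N}\,g(X,\mathtt{u})g(Y,\mathtt{u})\mathtt{u}^V,$$ where $$\mathtt{L}=\frac{a'(t)}{2a(t)},\qquad \mathtt{M}=\frac{2b(t)-a'(t)}{2(a(t)+2tb(t))},\qquad \mathtt{N}=\frac{a(t)b'(t)-2a'(t)b(t)}{2a(t)(a(t)+2tb(t))}.$$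
   Context: For $(p,\mathtt{u})\in T(M)$ put $t=\frac12 g_p(\mathtt{u},\mathtt{u})$. $X^H,X^V$ denote the horizontal lift (with respect to $\nabla$) and the vertical lift of $X$ to $T(M)$. The functions $a,b:[0,+\infty)\to[0,+\infty)$ are smooth with $a>0$, and $$g_A(X^H,Y^H)=g(X,Y),\quad g_A(X^H,Y^V)=0,\quad g_A(X^V,Y^V)=a(t)g(X,Y)+b(t)g(X,\mathtt{u})g(Y,\mathtt{u})$$ at $(p,\mathtt{u})$. $R_{XY}=\nabla_X\nabla_Y-\nabla_Y\nabla_X-\nabla_{[X,Y]}$ is the curvature of $g$. *)

(* Defs.v *)
From HB Require Import structures.
From mathcomp Require Import all_boot all_order all_algebra.
From mathcomp Require Import all_classical all_reals all_analysis.

Set Implicit Arguments.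
Unset Strict Implicit.
Unset Printing Implicit Defensive.

Import Order.TTheory GRing.Theory Num.Theory.
Import numFieldNormedType.Exports.

Local Open Scope classical_set_scope.
Local Open Scope ring_scope.

Section SmoothFunctions.
Variable R : realType.

(* C^oo on an open set: every iterated directional derivative is Frechet
   differentiable, hence exists and is continuous, at each point of U. *)
Definition smooth_on (n : nat) (V : normedModType R) (U : set 'rV[R]_n)
    (f : 'rV[R]_n -> V) : Prop :=
  forall (vs : seq 'rV[R]_n) (x : 'rV[R]_n), U x ->
    differentiable (foldr (fun v (h : 'rV[R]_n -> V) => 'D_v h) f vs) x.

(* Functions on [0, +oo) are total functions on R of which only the values on
   [0, +oo) matter: all increments h below satisfy 0 <= t + h, so that the
   derivative is one-sided at t = 0. *)
Definition incr_filter (t : R) : set_system R :=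
  within [set h : R | 0 <= t + h] (0 : R)^'.

Definition incr_ratio (f : R -> R) (t h : R) : R := h^-1 * (f (t + h) - f t).

Definition hderive (f : R -> R) (t : R) : R :=
  lim (incr_ratio f t h @[h --> incr_filter t]).

Definition hsmooth (f : R -> R) : Prop :=
  forall (k : nat) (t : R), 0 <= t ->
    cvg (incr_ratio (iter k hderive f) t h @[h --> incr_filter t]).

End SmoothFunctions.

Section Manifolds.
Variable R : realType.

(* A set with an atlas modelled on R^n.  The chart i is the map coord i on
   dom i, and param i is its inverse (the values of coord i outside dom i and
   of param i outside the image of the chart are irrelevant).  A chart pref p
   around p is selected once and for all; a tangent vector at p is represented
   by its row of components with respect to the chart pref p, so that every
   tangent space is 'rV[R]_n, a vector field is a function M -> 'rV[R]_n, and
   components in another chart are obtained by tcoord below. *)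
Record charted (n : nat) : Type := Charted {
  carrier :> Type;
  index : Type;
  dom : index -> set carrier;
  coord : index -> carrier -> 'rV[R]_n;
  param : index -> 'rV[R]_n -> carrier;
  pref : carrier -> index
}.

Arguments dom {n} M i : rename.
Arguments coord {n} M i p : rename.
Arguments param {n} M i x : rename.
Arguments pref {n} M p : rename.

(* The carrier with the topology in which the charts are homeomorphisms. *)
Definition mspace (n : nat) (M : charted n) : Type := carrier M.

Section Topology.
Variables (n : nat) (M : charted n).
HB.instance Definition _ := gen_eqMixin (mspace M).
HB.instance Definition _ := gen_choiceMixin (mspace M).
HB.instance Definition _ := isSubBaseTopological.Build (mspace M)
  [set A : set (mspace M) | exists i (O : set 'rV[R]_n),
    open O /\ A = dom M i `&` coord M i @^-1` O] id.
End Topology.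

Definition manifold (n : nat) (M : charted n) : Prop :=
  [/\ forall p, dom M (pref M p) p,
      forall i p, dom M i p -> param M i (coord M i p) = p,
      forall i j, open (coord M i @` (dom M i `&` dom M j)),
      forall i j, smooth_on (coord M i @` (dom M i `&` dom M j))
                            (coord M j \o param M i)
    & hausdorff_space (mspace M) /\ @second_countable (mspace M)].

Section Calculus.
Variables (n : nat) (M : charted n).

Definition smooth_fun (f : M -> R) : Prop :=
  forall i, smooth_on (coord M i @` dom M i) (f \o param M i).

Definition tcoord (i : index M) (p : M) (v : 'rV[R]_n) : 'rV[R]_n :=
  'D_v (coord M i \o param M (pref M p)) (coord M (pref M p) p).

Definition field_coord (X : M -> 'rV[R]_n) (i : index M) (x : 'rV[R]_n)
    : 'rV[R]_n :=
  tcoord i (param M i x) (X (param M i x)).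

Definition smooth_field (X : M -> 'rV[R]_n) : Prop :=
  forall i, smooth_on (coord M i @` dom M i) (field_coord X i).

(* The function X f. *)
Definition field_deriv (X : M -> 'rV[R]_n) (f : M -> R) (p : M) : R :=
  'D_(X p) (f \o param M (pref M p)) (coord M (pref M p) p).

(* [X, Y] f = X (Y f) - Y (X f), in components: X^j d_j Y^i - Y^j d_j X^i. *)
Definition bracket (X Y : M -> 'rV[R]_n) (p : M) : 'rV[R]_n :=
  'D_(X p) (field_coord Y (pref M p)) (coord M (pref M p) p)
  - 'D_(Y p) (field_coord X (pref M p)) (coord M (pref M p) p).

Definition riemannian_metric (g : M -> 'rV[R]_n -> 'rV[R]_n -> R) : Prop :=
  [/\ forall p c x y z, g p (c *: x + y) z = c * g p x z + g p y z,
      forall p x y, g p x y = g p y x,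
      forall p x, x != 0 -> 0 < g p x x
    & forall X Y, smooth_field X -> smooth_field Y ->
        smooth_fun (fun p => g p (X p) (Y p))].

(* Only the values on smooth vector fields are constrained. *)
Definition connection
    (nabla : (M -> 'rV[R]_n) -> (M -> 'rV[R]_n) -> M -> 'rV[R]_n) : Prop :=
  [/\ forall X Y, smooth_field X -> smooth_field Y -> smooth_field (nabla X Y),
      forall f X X' Y, smooth_fun f ->
        smooth_field X -> smooth_field X' -> smooth_field Y -> forall p,
        nabla (fun q => f q *: X q + X' q) Y p
        = f p *: nabla X Y p + nabla X' Y p,
      forall X Y Y', smooth_field X -> smooth_field Y -> smooth_field Y' ->
        forall p, nabla X (fun q => Y q + Y' q) p = nabla X Y p + nabla X Y' p
    & forall f X Y, smooth_fun f -> smooth_field X -> smooth_field Y ->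
        forall p, nabla X (fun q => f q *: Y q) p
                  = field_deriv X f p *: Y p + f p *: nabla X Y p].

Definition levi_civita (g : M -> 'rV[R]_n -> 'rV[R]_n -> R)
    (nabla : (M -> 'rV[R]_n) -> (M -> 'rV[R]_n) -> M -> 'rV[R]_n) : Prop :=
  [/\ connection nabla,
      forall X Y, smooth_field X -> smooth_field Y -> forall p,
        nabla X Y p - nabla Y X p = bracket X Y p
    & forall X Y Z, smooth_field X -> smooth_field Y -> smooth_field Z ->
        forall p, field_deriv X (fun q => g q (Y q) (Z q)) p
                  = g p (nabla X Y p) (Z p) + g p (Y p) (nabla X Z p)].

(* Some smooth vector field with value v at p. *)
Definition extend (p : M) (v : 'rV[R]_n) : M -> 'rV[R]_n :=
  xget (fun=> 0) [set X | smooth_field X /\ X p = v].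

Variable nabla : (M -> 'rV[R]_n) -> (M -> 'rV[R]_n) -> M -> 'rV[R]_n.

Definition curvature (X Y Z : M -> 'rV[R]_n) (p : M) : 'rV[R]_n :=
  nabla X (nabla Y Z) p - nabla Y (nabla X Z) p - nabla (bracket X Y) Z p.

(* The curvature tensor R_{xy} z at p. *)
Definition curv (p : M) (x y z : 'rV[R]_n) : 'rV[R]_n :=
  curvature (extend p x) (extend p y) (extend p z) p.

End Calculus.

(* The differential at p of a map between manifolds. *)
Definition tangent_map (n m : nat) (M : charted n) (N : charted m)
    (F : M -> N) (p : M) (v : 'rV[R]_n) : 'rV[R]_m :=
  'D_v (coord N (pref N (F p)) \o F \o param M (pref M p))
       (coord M (pref M p) p).

Section TangentBundle.
Variables (n : nat) (M : charted n).

(* Points are pairs (p, u) with u in T_p M; the chart i of M induces the chart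
   (p, u) |-> (x^1, ..., x^n, u^1, ..., u^n) with u = u^k d/dx^k at p. *)
Definition tangent_bundle : charted (n + n) := {|
  carrier := (carrier M * 'rV[R]_n)%type;
  index := index M;
  dom := fun i => [set z | dom M i z.1];
  coord := fun i z => row_mx (coord M i z.1) (tcoord i z.1 z.2);
  param := fun i w =>
    let p := param M i (lsubmx w) in
    (p, 'D_(rsubmx w) (coord M (pref M p) \o param M i) (lsubmx w));
  pref := fun z => pref M z.1
|}.

(* The velocity at s = 0 of the curve s |-> (p, u + s v), where z = (p, u). *)
Definition vlift_at (z : tangent_bundle) (v : 'rV[R]_n) : 'rV[R]_(n + n) :=
  'D_1 (fun s : R => coord tangent_bundle (pref tangent_bundle z)
                       ((z.1, z.2 + s *: v) : tangent_bundle)) 0.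

Definition vlift (X : M -> 'rV[R]_n) (z : tangent_bundle) : 'rV[R]_(n + n) :=
  vlift_at z (X z.1).

Variable nabla : (M -> 'rV[R]_n) -> (M -> 'rV[R]_n) -> M -> 'rV[R]_n.

(* The horizontal lift of v to z = (p, u): if U is a vector field with U p = u,
   regarded as a map M -> T(M), it is dU(v) - (nabla_v U)^V; that is, dU(v)
   whenever U is parallel at p in the direction v. *)
Definition hlift_at (z : tangent_bundle) (v : 'rV[R]_n) : 'rV[R]_(n + n) :=
  let U := extend z.1 z.2 in
  tangent_map (fun q : M => (q, U q) : tangent_bundle) z.1 v
  - vlift_at z (nabla (extend z.1 v) U z.1).

Definition hlift (X : M -> 'rV[R]_n) (z : tangent_bundle) : 'rV[R]_(n + n) :=
  hlift_at z (X z.1).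

Variable g : M -> 'rV[R]_n -> 'rV[R]_n -> R.

(* t = g_p(u, u) / 2 at z = (p, u). *)
Definition energy (z : tangent_bundle) : R := g z.1 z.2 z.2 / 2.

Definition is_gA (a b : R -> R)
    (gA : tangent_bundle -> 'rV[R]_(n + n) -> 'rV[R]_(n + n) -> R) : Prop :=
  [/\ riemannian_metric gA,
      forall X Y, smooth_field X -> smooth_field Y -> forall z,
        gA z (hlift X z) (hlift Y z) = g z.1 (X z.1) (Y z.1),
      forall X Y, smooth_field X -> smooth_field Y -> forall z,
        gA z (hlift X z) (vlift Y z) = 0
    & forall X Y, smooth_field X -> smooth_field Y -> forall z,
        gA z (vlift X z) (vlift Y z)
        = a (energy z) * g z.1 (X z.1) (Y z.1)
          + b (energy z) * g z.1 (X z.1) z.2 * g z.1 (Y z.1) z.2].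

End TangentBundle.

End Manifolds.

(* Main.v *)
(* In a chart the connection reads nabla_X Y = D_X Y + Gamma(X, Y): bump
   functions globalise a constant local frame, so that nabla is local and
   Gamma is determined by the nabla_{E_i} E_j.  In the induced chart of T(M) the
   lifts at (p, u) are X^H = (X, - Gamma(X, u)) and X^V = (0, X), and
   differentiating these expressions gives
     [X^H, Y^H] = [X, Y]^H - (R_XY u)^V, [X^H, Y^V] = (nabla_X Y)^V,
     [X^V, Y^V] = 0.
   Moreover t is constant along horizontal lifts, while X^V t = g(X, u).  The
   formulas follow by testing Koszul's formula for g_A against the lifts, which
   span each tangent space; the pair symmetry of the curvature tensor turns
   g(R_XZ u, Y) into g(R_uY X, Z). *)
From HB Require Import structures.
Require Import Defs.
From mathcomp Require Import all_boot all_order all_algebra.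
From mathcomp Require Import all_classical all_reals all_analysis.
From mathcomp Require Import finmap ring lra.
Import Order.TTheory GRing.Theory Num.Theory.
Import numFieldNormedType.Exports.
Set Implicit Arguments.
Unset Strict Implicit.
Unset Printing Implicit Defensive.
Local Open Scope classical_set_scope.
Local Open Scope ring_scope.

(** * Differential calculus on R^n *)

(** The hypotheses speak only of globally smooth fields, while tangent vectors are stored in the
    components of a preferred chart that may jump from point to point. So fields are read in one
    fixed chart through [field_coord], and vectors at a point are turned back into global fields by
    [extend]. Extension by zero of a field cut off inside a chart is smooth because, M being
    Hausdorff, the image of a compact set of coordinates is closed. In a chart the metric, [Gamma]
    and the derivative of a transition map are families of linear or bilinear maps evaluated at
    moving arguments. One Leibniz rule for such families gives the transformation of brackets, the
    curvature formula, its skew symmetry and the brackets of lifts; what should cancel then does so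
    by the symmetry of second derivatives. At u = 0 the argument t of [a] and [b] is the end point
    of the half-line, where only a one-sided derivative exists. As t is never negative, the chain
    rule through t survives there. *)

Section Differentials.
Context {R : realType} {V W : normedModType R}.
Implicit Types (f g : V -> W) (x v w : V).

Lemma near_eq_differentiable f g x :
  (\near x, f x = g x) -> differentiable f x -> differentiable g x.
Proof.
move=> fg df.
have e : g \o shift x = cst (g x) + 'd f x +o_ 0 id.
  apply/eqaddoP => _/posnumP[e].
  have /eqaddoP/(_ e%:num) /(_ [gt0 of e%:num]) := diff_locally df.
  have : \forall h \near 0, f (h + x) = g (h + x).
    move: fg; rewrite (near_shift 0) /=; apply: filterS => y /=.
    by rewrite subr0.
  by apply: filterS2 => h e1; rewrite !fctE /= e1 (nbhs_singleton fg).
have dg : 'd g x = 'd f x :> (V -> W).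
  by apply: diff_unique => //; exact: diff_continuous.
by apply/diff_locallyP; rewrite dg; split => //; exact: diff_continuous.
Qed.

Lemma derive_linear f x (c : R) v w : differentiable f x ->
  'D_(c *: v + w) f x = c *: 'D_v f x + 'D_w f x.
Proof. by move=> df; rewrite !deriveE// linearP. Qed.

Lemma deriveZv f x (c : R) v : differentiable f x -> 'D_(c *: v) f x = c *: 'D_v f x.
Proof. by move=> df; rewrite !deriveE// linearZ. Qed.

Lemma deriveBv f x v w : differentiable f x ->
  'D_(v - w) f x = 'D_v f x - 'D_w f x.
Proof. by move=> df; rewrite !deriveE// linearB. Qed.

Lemma derive_sumv f x m (v : 'I_m -> V) : differentiable f x ->
  'D_(\sum_i v i) f x = \sum_i 'D_(v i) f x.
Proof.
by move=> df; rewrite deriveE// linear_sum; apply: eq_bigr => i _; rewrite deriveE.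
Qed.

End Differentials.

Section Compositions.
Context {R : realType}.

Lemma derive_comp (U V W : normedModType R) (g : U -> V) (f : V -> W) x v :
  differentiable g x -> differentiable f (g x) ->
  'D_v (fun y => f (g y)) x = 'D_('D_v g x) f (g x).
Proof.
move=> dg df; rewrite !deriveE//; last exact: (differentiable_comp dg df).
by rewrite (diff_comp dg df).
Qed.

Lemma scaler_is_bilinear (V : normedModType R) :
  bilinear_for (GRing.Scale.Law.clone _ _ *:%R _) (GRing.Scale.Law.clone _ _ *:%R _)
    (fun (k : R) (v : V) => k *: v).
Proof.
split=> [u a x y|u a x y] /=; first by rewrite scalerDl scalerA.
by rewrite scalerDr !scalerA mulrC.
Qed.

(** Scaling is a continuous bilinear map on [R * V], so the rule is the chain rule through the pair
    [(k y, f y)]. *)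
Lemma scale_rule (U V : normedModType R) (k : U -> R) (f : U -> V) x :
  differentiable k x -> differentiable f x ->
  is_diff x (fun y => k y *: f y) (fun v => k x *: 'd f x v + 'd k x v *: f x).
Proof.
move=> dk df.
pose m := bilinear_isBilinear.Build R R V V _ _ (fun (k : R) (v : V) => k *: v)
  (scaler_is_bilinear V).
pose s : {bilinear R -> V -> V} := HB.pack (fun (k : R) (v : V) => k *: v) m.
have sc : continuous (fun p : R * V => s p.1 p.2) by exact: scale_continuous.
have ds p : is_diff p (fun q : R * V => s q.1 q.2) (fun q => s p.1 q.2 + s q.1 p.2).
  by apply: DiffDef; [exact: differentiable_bilin|rewrite diff_bilin].
have -> : (fun y => k y *: f y) = (fun q : R * V => s q.1 q.2) \o (fun y => (k y, f y)) by [].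
exact: is_diff_comp (is_diff_pair (differentiableP dk) (differentiableP df)) (ds _).
Qed.

Lemma differentiable_scale (U V : normedModType R) (k : U -> R) (f : U -> V) x :
  differentiable k x -> differentiable f x -> differentiable (fun y => k y *: f y) x.
Proof. by move=> dk df; have [] := scale_rule dk df. Qed.

Lemma derive_scale (U V : normedModType R) (k : U -> R) (f : U -> V) x v :
  differentiable k x -> differentiable f x ->
  'D_v (fun y => k y *: f y) x = k x *: 'D_v f x + 'D_v k x *: f x.
Proof.
move=> dk df; have [dkf e] := scale_rule dk df.
by rewrite !deriveE// e.
Qed.

End Compositions.

Section RowVectors.
Context {R : realType}.

Lemma row_sum_scale n (v : 'rV[R]_n) : v = \sum_j v 0 j *: delta_mx 0 j.
Proof. exact: row_sum_delta. Qed.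

Lemma differentiable_rV (V : normedModType R) n (f : V -> 'rV[R]_n) x :
  (forall j, differentiable (fun y => f y 0 j) x) -> differentiable f x.
Proof.
move=> df.
have -> : f = \sum_j (fun y => f y 0 j *: delta_mx 0 j).
  by apply/funext => y; rewrite fct_sumE; exact: row_sum_scale.
by apply: differentiable_sum => j; exact: (differentiableZl _ (df j)).
Qed.

Lemma differentiable_entry (V : normedModType R) n (f : V -> 'rV[R]_n) x j :
  differentiable f x -> differentiable (fun y => f y 0 j) x.
Proof.
move=> df; exact: (@differentiable_comp _ _ _ _ f (fun N : 'rV[R]_n => N 0 j : R) x df
  (differentiable_coord _ _ _)).
Qed.

Lemma derive_entry (V : normedModType R) n (f : V -> 'rV[R]_n) x v j :
  differentiable f x -> 'D_v (fun y => f y 0 j) x = 'D_v f x 0 j.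
Proof. by move=> df; rewrite (derive_mx (@diff_derivable _ _ _ f x v df)) mxE. Qed.

Lemma derive_basis (V : normedModType R) n (f : 'rV[R]_n -> V) x v :
  differentiable f x ->
  'D_v f x = \sum_j v 0 j *: 'D_(delta_mx 0 j) f x.
Proof.
move=> df; rewrite {1}(row_sum_scale v) derive_sumv//.
by apply: eq_bigr => j _; rewrite deriveZv.
Qed.

End RowVectors.

(** * Calculus of iterated differentiability on open sets *)

Section Smoothness.
Context {R : realType}.

Section Ck.
Variables (n : nat) (V : normedModType R) (U : set 'rV[R]_n).

(* Off by one: [Ck 0] already asks for differentiability. *)
Fixpoint Ck (k : nat) (f : 'rV[R]_n -> V) : Prop :=
  (forall x, U x -> differentiable f x) /\
  if k is k'.+1 then forall v, Ck k' ('D_v f) else True.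

End Ck.

Lemma CkD n (V : normedModType R) k (U : set 'rV[R]_n) (f : 'rV[R]_n -> V) x :
  Ck U k f -> U x -> differentiable f x.
Proof. by case: k => [|k] [df _]; exact: df. Qed.

(** [foldr] applies the last vector of the list first, so peeling off the innermost derivative, as
    [Ck] does, means peeling the list from its end. *)
Lemma smooth_onP n (V : normedModType R) (U : set 'rV[R]_n) (f : 'rV[R]_n -> V) :
  smooth_on U f <-> forall k, Ck U k f.
Proof.
split=> [sf k|Cf vs].
  elim: k f sf => [|k IH] f sf; split=> //; try exact: (sf [::]).
  by move=> v; apply: IH => vs x Ux; have := sf (rcons vs v) x Ux; rewrite foldr_rcons.
elim/last_ind: vs f Cf => [|vs v IH] f Cf x Ux; first exact: CkD (Cf 0%N) _.
by rewrite foldr_rcons; apply: IH => // k; have [_ /(_ v)] := Cf k.+1.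
Qed.

Lemma CkS n (V : normedModType R) k (U : set 'rV[R]_n) (f : 'rV[R]_n -> V) :
  Ck U k.+1 f -> Ck U k f.
Proof. by elim: k f => [|k IH] f [df Df]; split=> // v; exact: IH. Qed.

Lemma Ck_subset n (V : normedModType R) k (U U' : set 'rV[R]_n) (f : 'rV[R]_n -> V) :
  U' `<=` U -> Ck U k f -> Ck U' k f.
Proof.
move=> UU; elim: k f => [|k IH] f [df Df].
  by split=> // x Ux; exact: df (UU _ Ux).
by split=> [x Ux|v]; [exact: df (UU _ Ux)|exact: (IH _ (Df v))].
Qed.

(** Openness of [U] is what lets equality on [U] pass to derivatives, which depend on a whole
    neighbourhood. *)
Lemma Ck_eq n (V : normedModType R) k (U : set 'rV[R]_n) (f g : 'rV[R]_n -> V) :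
  open U -> (forall x, U x -> f x = g x) -> Ck U k f -> Ck U k g.
Proof.
move=> oU.
have near_eq (h1 h2 : 'rV[R]_n -> V) x :
    (forall x, U x -> h1 x = h2 x) -> U x -> \near x, h1 x = h2 x.
  by move=> h12 Ux; apply: filterS (open_nbhs_nbhs (conj oU Ux)) => y; exact: h12.
elim: k f g => [|k IH] f g fg [df Df].
  by split=> // x Ux; apply: near_eq_differentiable (df _ Ux); exact: near_eq.
split=> [x Ux|v]; first by apply: near_eq_differentiable (df _ Ux); exact: near_eq.
apply: (IH _ _ _ (Df v)) => x Ux; apply: near_eq_derive; exact: near_eq.
Qed.

Lemma Ck_cst n (V : normedModType R) k (U : set 'rV[R]_n) (c : V) :
  open U -> Ck U k (cst c).
Proof.
move=> oU; elim: k c => [|k IH] c; split=> // [v].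
apply: (Ck_eq oU _ (IH 0)) => x _; by rewrite derive_cst.
Qed.

Lemma Ck_linear n (V : normedModType R) k (U : set 'rV[R]_n) (L : {linear 'rV[R]_n -> V}) :
  open U -> continuous L -> Ck U k L.
Proof.
move=> oU cL; have dL x : differentiable L x by exact: linear_differentiable.
case: k => [|k]; split=> // v.
apply: (Ck_eq oU _ (Ck_cst k (L v) oU)) => x _.
by rewrite deriveE// diff_lin.
Qed.

Lemma CkDD n (V : normedModType R) k (U : set 'rV[R]_n) (f g : 'rV[R]_n -> V) :
  open U -> Ck U k f -> Ck U k g -> Ck U k (fun x => f x + g x).
Proof.
move=> oU; elim: k f g => [|k IH] f g [df Df] [dg Dg].
  by split=> // x Ux; apply: differentiableD; [exact: df|exact: dg].
split=> [x Ux|v]; first by apply: differentiableD; [exact: df|exact: dg].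
apply: (Ck_eq oU _ (IH _ _ (Df v) (Dg v))) => x Ux.
by rewrite -deriveD//; apply: diff_derivable; [exact: df|exact: dg].
Qed.

Lemma Ck_scale n (V : normedModType R) k (U : set 'rV[R]_n) (f : 'rV[R]_n -> R)
    (g : 'rV[R]_n -> V) :
  open U -> Ck U k f -> Ck U k g -> Ck U k (fun x => f x *: g x).
Proof.
move=> oU; elim: k f g => [|k IH] f g Cf Cg.
  by split=> // x Ux; apply: differentiable_scale; [exact: (CkD Cf)|exact: (CkD Cg)].
split=> [x Ux|v]; first by apply: differentiable_scale; [exact: (CkD Cf)|exact: (CkD Cg)].
have [_ /(_ v) Df] := Cf; have [_ /(_ v) Dg] := Cg.
apply: (Ck_eq oU _ (CkDD oU (IH _ _ (CkS Cf) Dg) (IH _ _ Df (CkS Cg)))) => x Ux.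
by rewrite derive_scale//; [exact: (CkD Cf)|exact: (CkD Cg)].
Qed.

Lemma Ck_sum n (V : normedModType R) k (U : set 'rV[R]_n) m (f : 'I_m -> 'rV[R]_n -> V) :
  open U -> (forall j, Ck U k (f j)) -> Ck U k (fun x => \sum_j f j x).
Proof.
move=> oU Cf; elim: m f Cf => [|m IH] f Cf.
  by apply: (Ck_eq oU _ (Ck_cst k 0 oU)) => x _; rewrite big_ord0.
have := CkDD oU (IH (fun j => f (widen_ord (leqnSn m) j)) (fun j => Cf _)) (Cf ord_max).
by apply: Ck_eq => // x _; rewrite big_ord_recr.
Qed.

Lemma Ck_entry n m k (U : set 'rV[R]_n) (f : 'rV[R]_n -> 'rV[R]_m) j :
  open U -> Ck U k f -> Ck U k (fun x => f x 0 j).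
Proof.
move=> oU; elim: k f => [|k IH] f Cf.
  by split=> // x Ux; apply: differentiable_entry => //; exact: (CkD Cf).
split=> [x Ux|v]; first by apply: differentiable_entry => //; exact: (CkD Cf).
have [_ /(_ v) Df] := Cf.
by apply: (Ck_eq oU _ (IH _ Df)) => x Ux; rewrite derive_entry//; exact: (CkD Cf).
Qed.

Lemma Ck_rV n m k (U : set 'rV[R]_n) (f : 'rV[R]_n -> 'rV[R]_m) :
  open U -> (forall j, Ck U k (fun x => f x 0 j)) -> Ck U k f.
Proof.
move=> oU Cf.
apply: (Ck_eq oU _ (Ck_sum oU
  (fun j => Ck_scale oU (Cf j) (Ck_cst k (delta_mx 0 j : 'rV[R]_m) oU)))) => x _.
by rewrite -row_sum_scale.
Qed.

(** The chain rule differentiates [f] in the direction ['D_v g x], which moves with the point.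
    Expanding that direction in the standard basis leaves sums of products of functions covered by
    the induction hypothesis. *)
Lemma Ck_comp n m (V : normedModType R) k (U : set 'rV[R]_n) (W : set 'rV[R]_m)
    (g : 'rV[R]_n -> 'rV[R]_m) (f : 'rV[R]_m -> V) :
  open U -> Ck U k g -> Ck W k f -> (forall x, U x -> W (g x)) ->
  Ck U k (fun x => f (g x)).
Proof.
move=> oU + + UW; elim: k f g UW => [|k IH] f g UW Cg Cf.
  by split=> // x Ux; apply: (differentiable_comp (CkD Cg Ux)); exact: CkD Cf (UW _ Ux).
split=> [x Ux|v]; first by apply: (differentiable_comp (CkD Cg Ux)); exact: CkD Cf (UW _ Ux).
have [_ /(_ v) Dg] := Cg; have [_ Df] := Cf.
have := Ck_sum oU (fun j => Ck_scale oU (Ck_entry j oU Dg)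
  (IH _ _ UW (CkS Cg) (Df (delta_mx 0 j)))).
apply: Ck_eq => // x Ux.
have dg := CkD Cg Ux; have df := CkD Cf (UW _ Ux).
by rewrite (derive_comp _ dg df) -(derive_basis _ df).
Qed.

Lemma Ck_local n (V : normedModType R) k (U : set 'rV[R]_n) (f : 'rV[R]_n -> V) :
  (forall x, U x -> exists2 N, nbhs x N & Ck N k f) -> Ck U k f.
Proof.
elim: k f => [|k IH] f Cf.
  by split=> // x /Cf[N nN CN]; exact: CkD CN (nbhs_singleton nN).
split=> [x /Cf[N nN CN]|v]; first exact: CkD CN (nbhs_singleton nN).
by apply: IH => x /Cf[N nN [_ /(_ v) CN]]; exists N.
Qed.

End Smoothness.

(** * Symmetry of second derivatives *)

Section Schwarz.
Context {R : realType} {n : nat}.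

Lemma diff_remainder (V : normedModType R) (F : 'rV[R]_n -> V) x (e : R) : differentiable F x -> 0 < e ->
  exists2 d, 0 < d & forall k, `|k| < d -> `|F (k + x) - F x - 'd F x k| <= e * `|k|.
Proof.
move=> dF e0; have /eqaddoP/(_ e e0) := diff_locally dF.
move=> /nbhs_norm0P[d /= d0 D]; exists d => // k kd; have := D k kd.
by rewrite !fctE /= opprD addrA.
Qed.

(** The mean value theorem along [v], applied to the difference of [f] on the two edges of the
    parallelogram parallel to [v], turns the second difference into [h] times a difference of values
    of [F]. The first-order expansion of [F] at [x] then produces its derivative along [w]. *)
Lemma second_difference (f : 'rV[R]_n -> R) (U : set 'rV[R]_n) x v w (e : R) :
  open U -> U x -> Ck U 1 f -> 0 < e ->
  \forall h \near 0^'+, `| 'D_w ('D_v f) x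
     - (f (x + h *: v + h *: w) - f (x + h *: v) - f (x + h *: w) + f x) / h ^+ 2| <= e.
Proof.
move=> oU Ux Cf e0; set F := 'D_v f.
have [_ /(_ v) [dF _]] := Cf.
(* Every increment that occurs has norm at most [h * m]; the summand 1 keeps [m] positive when both
   vectors vanish. The tolerance [e / (2 * m)] makes each of the two remainders at most
   [e * h / 2]. *)
set m := `|v| + `|w| + 1; have m0 : 0 < m by rewrite /m ltr_wpDl.
have [d d0 D] := diff_remainder (dF x Ux) (divr_gt0 e0 (mulr_gt0 (ltr0n R 2) m0)).
have /nbhs_normP[r /= r0 Ur] := open_nbhs_nbhs (conj oU Ux).
(* The boolean switches the side [h *: w] of the parallelogram on or off, so that both parallel
   edges are treated at once. *)
have sm (c h : R) (b : bool) : 0 <= c <= h -> `|c *: v + (b%:R * h) *: w| <= h * m.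
  move=> /andP[c0 ch]; rewrite (le_trans (ler_normD _ _))// !normrZ.
  have h0 : 0 <= h by exact: le_trans ch.
  rewrite (ger0_norm c0) /m !mulrDr mulr1 -addrA lerD//.
    by rewrite ler_wpM2r.
  case: b => /=; rewrite ?normr0 ?mul0r ?mul0r.
    by rewrite normr1 mul1r (ger0_norm h0) lerDl.
  by rewrite addr_ge0// mulr_ge0.
near=> h.
have h0 : 0 < h by near: h; exact: nbhs_right_gt.
have hd : h * m < d.
  by rewrite -ltr_pdivlMr//; near: h; apply: nbhs_right_lt; rewrite divr_gt0.
have hr : h * m < r.
  by rewrite -ltr_pdivlMr//; near: h; apply: nbhs_right_lt; rewrite divr_gt0.
have inU c (b : bool) : 0 <= c <= h -> U (c *: v + (x + (b%:R * h) *: w)).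
  move=> ch; apply: Ur; rewrite /ball_ /= [c *: v + _]addrCA opprD addrA subrr add0r.
  by rewrite normrN; exact: le_lt_trans (sm _ _ _ ch) hr.
pose g (b : bool) (s : R) := s *: v + (x + (b%:R * h) *: w).
have dg b s : differentiable (g b) s.
  apply: (@differentiableD _ _ _ (fun s : R => s *: v) (cst _)) => //.
have Dg b s : 'D_1 (g b) s = v.
  have ds : differentiable (fun s : R => s *: v) s by [].
  rewrite /g (@deriveD _ _ _ (fun s : R => s *: v) (cst _))//; last exact: diff_derivable.
  by rewrite derive_cst addr0 deriveE// diff_val scale1r.
pose phi (z : R) := f (g true z) - f (g false z).
have dphi : forall s : R, 0 <= s <= h -> is_derive s 1 phi (F (g true s) - F (g false s)).
  move=> s sh.
  have df b : differentiable f (g b s) by exact: (CkD Cf (inU s b sh)).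
  have H b : is_derive s 1 (fun s => f (g b s)) (F (g b s)).
    apply: (@DeriveDef _ _ _ _ _ (fun s => f (g b s))).
      apply: diff_derivable; exact: (@differentiable_comp _ _ _ _ (g b) f _ (dg b s) (df b)).
    by rewrite (derive_comp _ (dg b s) (df b)) Dg.
  exact: is_deriveB.
have [||c] := @MVT _ phi (fun s => F (g true s) - F (g false s)) 0 h h0.
- by move=> s; rewrite in_itv /= => /andP[s0 sh]; apply: dphi; rewrite !ltW.
- apply: derivable_within_continuous => s; rewrite in_itv /= => sh.
  by have [] := dphi s sh.
rewrite in_itv /= subr0 => /andP[c0 ch] E.
have cch : 0 <= c <= h by rewrite !ltW.
have gE b : g b c = c *: v + (b%:R * h) *: w + x by rewrite /g addrCA addrC.
have T := D _ (le_lt_trans (sm c h true cch) hd).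
have T' := D _ (le_lt_trans (sm c h false cch) hd).
have -> : f (x + h *: v + h *: w) - f (x + h *: v) - f (x + h *: w) + f x = phi h - phi 0.
  rewrite /phi /g !scale0r !add0r !mul1r !mul0r !scale0r !addr0.
  rewrite [h *: v + (x + _)]addrCA addrA [h *: v + x]addrC; ring.
rewrite E deriveE; last exact: dF.
set L := 'd F x in T T' *; rewrite -!gE in T T'.
have {}T : `|F (g true c) - F x - L (c *: v + (true%:R * h) *: w)| <= e * h / 2.
  rewrite (le_trans T)// (le_trans (ler_wpM2l _ (sm c h true cch)))//.
    by rewrite divr_ge0 ?mulr_ge0// ltW.
  by rewrite le_eqVlt; apply/orP; left; apply/eqP; field; rewrite gt_eqF.
have {}T' : `|F (g false c) - F x - L (c *: v + (false%:R * h) *: w)| <= e * h / 2.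
  rewrite (le_trans T')// (le_trans (ler_wpM2l _ (sm c h false cch)))//.
    by rewrite divr_ge0 ?mulr_ge0// ltW.
  by rewrite le_eqVlt; apply/orP; left; apply/eqP; field; rewrite gt_eqF.
have e1 : L (c *: v + (true%:R * h) *: w) = c * L v + h * L w.
  by rewrite linearD !linearZ mul1r.
have e2 : L (c *: v + (false%:R * h) *: w) = c * L v.
  by rewrite mul0r scale0r addr0 linearZ.
move: T T'; rewrite e1 e2; clear e1 e2.
move: (L w : R) (c * L v) (F (g true c)) (F (g false c)) (F x) => l k A B C T T'.
(* A difference of the two remainders of [F]: the value at [x] and the contribution [k] of [v]
   cancel, leaving [h * l]. *)
have -> : l - (A - B) * h / h ^+ 2 = ((B - C - k) - (A - C - (k + h * l))) / h.
  by field; rewrite gt_eqF.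
rewrite normrM normfV (gtr0_norm h0) ler_pdivrMr// (le_trans (ler_normB _ _))//.
by rewrite (splitr (e * h)) lerD.
Unshelve. all: by end_near. Qed.

(** The second difference is symmetric in [v] and [w], and for a common small [h] its quotient is
    within [e / 2] of both mixed derivatives. *)
Lemma derive_comm (f : 'rV[R]_n -> R) (U : set 'rV[R]_n) x v w :
  open U -> U x -> Ck U 1 f -> 'D_w ('D_v f) x = 'D_v ('D_w f) x.
Proof.
move=> oU Ux Cf; apply/eqP; rewrite -subr_eq0 -normr_le0; apply/ler_addgt0Pl => e e0.
have e20 : 0 < e / 2 by rewrite divr_gt0.
have A := second_difference v w oU Ux Cf e20.
have B := second_difference w v oU Ux Cf e20.
have [h [Ah Bh]] := filter_ex (filterI A B).
rewrite addr0.
have E : f (x + h *: w + h *: v) - f (x + h *: w) - f (x + h *: v) + f x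
    = f (x + h *: v + h *: w) - f (x + h *: v) - f (x + h *: w) + f x.
  by congr (_ + _); rewrite [LHS]addrAC [x + _ + _]addrAC.
move: Ah Bh; rewrite E; move: (_ / _ : R) ('D_w _ x) ('D_v _ x) => q a b.
by rewrite !ler_norml => /andP[? ?] /andP[? ?]; apply/andP; split; lra.
Qed.

Lemma derive_comm_rV m (f : 'rV[R]_n -> 'rV[R]_m) (U : set 'rV[R]_n) x v w :
  open U -> U x -> Ck U 1 f -> 'D_w ('D_v f) x = 'D_v ('D_w f) x.
Proof.
move=> oU Ux Cf; apply/rowP => j; have [dF DF] := Cf.
have E u v' : 'D_v' ('D_u f) x 0 j = 'D_v' ('D_u (fun y => f y 0 j)) x.
  rewrite -derive_entry; last by have [dDF _] := DF u; exact: dDF.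
  apply: near_eq_derive; apply: filterS (open_nbhs_nbhs (conj oU Ux)) => y Uy.
  by rewrite derive_entry//; exact: dF.
rewrite [LHS]E [RHS]E; apply: (derive_comm _ _ oU Ux); exact: Ck_entry.
Qed.

End Schwarz.

(** * Leibniz rules for families of linear and bilinear maps *)

Section Families.
Context {R : realType}.

(** A predicate on bare functions rather than a bundled linear map, because the families below are
    linear only at the points of a chart or frame domain. *)
Definition lin n (V : normedModType R) (f : 'rV[R]_n -> V) : Prop :=
  forall c u v, f (c *: u + v) = c *: f u + f v.

Section Lin.
Variables (n : nat) (V : normedModType R) (f : 'rV[R]_n -> V).
Hypothesis lf : lin f.

Lemma lin0 : f 0 = 0.
Proof.
have := lf 1 0 0; rewrite !scale1r addr0 => /eqP.
by rewrite -subr_eq0 opprD addrA subrr add0r oppr_eq0 => /eqP.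
Qed.

Lemma linDE u v : f (u + v) = f u + f v.
Proof. by have := lf 1 u v; rewrite !scale1r. Qed.

Lemma linZE c u : f (c *: u) = c *: f u.
Proof. by have := lf c u 0; rewrite !addr0 lin0 addr0. Qed.

Lemma linNE u : f (- u) = - f u.
Proof. by rewrite -scaleN1r linZE scaleN1r. Qed.

Lemma linBE u v : f (u - v) = f u - f v.
Proof. by rewrite linDE linNE. Qed.

Lemma lin_sumE m (u : 'I_m -> 'rV[R]_n) : f (\sum_j u j) = \sum_j f (u j).
Proof.
by elim/big_ind2 : _ => [|x1 x2 y1 y2 <- <-|//]; [exact: lin0|exact: linDE].
Qed.

Lemma lin_basis v : f v = \sum_j v 0 j *: f (delta_mx 0 j).
Proof.
by rewrite {1}(row_sum_scale v) lin_sumE; apply: eq_bigr => j _; rewrite linZE.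
Qed.

End Lin.

Lemma lin_derive n (V : normedModType R) (f : 'rV[R]_n -> V) x :
  differentiable f x -> lin (fun v => 'D_v f x).
Proof. by move=> df c u v; exact: derive_linear. Qed.

Section Linear.
Variables (U V : normedModType R) (n : nat).
Variables (A : U -> 'rV[R]_n -> V) (w : U).
Hypothesis Alin : \forall y \near w, lin (A y).
Hypothesis dA : forall v, differentiable (A ^~ v) w.

Lemma differentiable_family (g : U -> 'rV[R]_n) :
  differentiable g w -> differentiable (fun y => A y (g y)) w.
Proof.
move=> dg.
apply: (@near_eq_differentiable _ _ _ (\sum_j (fun y => g y 0 j *: A y (delta_mx 0 j)))).
  by apply: filterS Alin => y Ay; rewrite fct_sumE -lin_basis.
apply: differentiable_sum => j; apply: differentiable_scale => //.
exact: differentiable_entry.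
Qed.

(** In finite dimension [A y (g y)] is the sum of the [g y 0 j *: A y (delta_mx 0 j)], which reduces
    the claim to the product rule and to the differentiability of [A] at fixed vectors. *)
Lemma derive_family (g : U -> 'rV[R]_n) xi : differentiable g w ->
  'D_xi (fun y => A y (g y)) w = 'D_xi (A ^~ (g w)) w + A w ('D_xi g w).
Proof.
move=> dg; have expand (h : U -> 'rV[R]_n) : differentiable h w ->
   'D_xi (fun y => A y (h y)) w = \sum_j (h w 0 j *: 'D_xi (A ^~ (delta_mx 0 j)) w
     + 'D_xi h w 0 j *: A w (delta_mx 0 j)).
  move=> dh; rewrite (@near_eq_derive _ _ _ _
      (\sum_j (fun y => h y 0 j *: A y (delta_mx 0 j)))); last first.
    by apply: filterS Alin => y Ay; rewrite fct_sumE -lin_basis.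
  have dj j : differentiable (fun y => h y 0 j) w by exact: differentiable_entry.
  rewrite derive_sum => [|j]; last exact/diff_derivable/differentiable_scale.
  by apply: eq_bigr => j _; rewrite derive_scale// derive_entry.
(* The expansion is used for [g] and for the constant [g w]; the second use identifies the sum in
   which only [A] is differentiated. *)
rewrite (expand g dg) (expand (cst (g w)) (differentiable_cst _ _)) big_split/=.
rewrite -(lin_basis (nbhs_singleton Alin)).
congr (_ + _); rewrite big_split/= [X in _ + X]big1 ?addr0// => j _.
by rewrite derive_cst mxE scale0r.
Qed.

End Linear.

Section Bilinear.
Variables (U V : normedModType R) (m n : nat).
Variables (B : U -> 'rV[R]_m -> 'rV[R]_n -> V) (w : U).
Hypothesis Bl : \forall y \near w, forall z, lin (B y ^~ z).
Hypothesis Br : \forall y \near w, forall v, lin (B y v).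
Hypothesis dB : forall v z, differentiable (fun y => B y v z) w.

Lemma differentiable_bifamily g h : differentiable g w -> differentiable h w ->
  differentiable (fun y => B y (g y) (h y)) w.
Proof.
move=> dg dh; apply: (@differentiable_family _ _ _ (fun y v => B y v (h y))) => //.
  by apply: filterS Bl => y; exact.
by move=> v; apply: (@differentiable_family _ _ _ (fun y => B y v)) => //; apply: filterS Br.
Qed.

Lemma derive_bifamily g h xi : differentiable g w -> differentiable h w ->
  'D_xi (fun y => B y (g y) (h y)) w = 'D_xi (fun y => B y (g w) (h w)) w
    + B w ('D_xi g w) (h w) + B w (g w) ('D_xi h w).
Proof.
move=> dg dh; rewrite (@derive_family _ _ _ (fun y v => B y v (h y)))//; first last.
- by move=> v; apply: (@differentiable_family _ _ _ (fun y => B y v)) => //; apply: filterS Br.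
- by apply: filterS Bl => y; exact.
rewrite (@derive_family _ _ _ (fun y => B y (g w)))//; last by apply: filterS Br.
by rewrite addrAC.
Qed.

End Bilinear.

Section Ck_families.
Variables (k n m p : nat) (V : normedModType R) (U : set 'rV[R]_p).
Hypothesis oU : open U.

Lemma Ck_family (A : 'rV[R]_p -> 'rV[R]_n -> V) (g : 'rV[R]_p -> 'rV[R]_n) :
  (forall x, U x -> lin (A x)) -> (forall v, Ck U k (A ^~ v)) -> Ck U k g ->
  Ck U k (fun x => A x (g x)).
Proof.
move=> lA CA Cg.
have := Ck_sum oU (fun j => Ck_scale oU (Ck_entry j oU Cg) (CA (delta_mx 0 j))).
by apply: Ck_eq => // x Ux; rewrite -(lin_basis (lA _ Ux)).
Qed.

Lemma Ck_bifamily (B : 'rV[R]_p -> 'rV[R]_n -> 'rV[R]_m -> V) g h :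
  (forall x, U x -> forall z, lin (B x ^~ z)) -> (forall x, U x -> forall v, lin (B x v)) ->
  (forall v z, Ck U k (fun x => B x v z)) -> Ck U k g -> Ck U k h ->
  Ck U k (fun x => B x (g x) (h x)).
Proof.
move=> lB rB CB Cg Ch; apply: (@Ck_family (fun x v => B x v (h x))) => //.
  by move=> x Ux; exact: lB.
move=> v.
have := Ck_sum oU (fun j => Ck_scale oU (Ck_entry j oU Ch) (CB v (delta_mx 0 j))).
by apply: Ck_eq => // x Ux; rewrite -(lin_basis (rB _ Ux v)).
Qed.

End Ck_families.

End Families.

(** * The chain rule through a one-sided derivative *)

Section HalfLine.
Context {R : realType} {V : normedModType R}.

(* The slope of [f] at [phi w], extended by its limit, is continuous along
   [phi]. *)
Lemma derive_halfline (f : R -> R) (phi : V -> R) (w xi : V) (c : R) :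
  (forall y, 0 <= phi y) ->
  cvg (incr_ratio f (phi w) h @[h --> incr_filter (phi w)]) ->
  is_derive w xi phi c ->
  is_derive w xi (fun y => f (phi y)) (hderive f (phi w) * c).
Proof.
move=> phi0; rewrite -/(hderive f (phi w)); set l := hderive f (phi w); set t := phi w => fl [dphi dE].
pose rho h := if h == 0 then l else incr_ratio f t h.
pose delta (s : R) := phi (s *: xi + w) - t.
have sl : (fun s : R => s^-1 *: delta s) @ 0^' --> c by rewrite -dE; exact: dphi.
have d0 : delta @ 0^' --> (0 : R).
  have i0 : id @ (0 : R)^' --> (0 : R) by exact: cvg_within.
  have H : (fun s => id s * (s^-1 *: delta s)) @ 0^' --> (0 * c : R) by exact: cvgM.
  rewrite mul0r in H.
  suff E : {near 0^', (fun s => id s * (s^-1 *: delta s)) =1 delta} by exact: cvg_trans (near_eq_cvg E) H.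
  near=> s; have s0 : s != 0 by near: s; exact: nbhs_dnbhs_neq.
  by rewrite /= mulrA divff// mul1r.
(* Nonnegativity of [phi] keeps [t + delta s] in the half-line, so the one-sided limit suffices.
   Where [delta s] vanishes the ratio carries no information and [rho] takes the value [l]. *)
have r0 : (rho \o delta) @ 0^' --> l.
  apply/cvgrPdist_lt => e e0.
  have /cvgrPdist_lt/(_ e e0) := fl.
  rewrite !near_withinE => H.
  have : \forall s \near 0^', delta s != 0 -> 0 <= t + delta s -> `|l - incr_ratio f t (delta s)| < e.
    exact: d0 H.
  apply: filterS => s Hs; rewrite /= /rho; case: eqP => [_|/eqP ds]; first by rewrite subrr normr0.
  by apply: Hs => //; rewrite /delta addrCA subrr addr0.
have H : (fun s : R => s^-1 *: (f (phi (s *: xi + w)) - f (phi w))) @ 0^' --> l * c.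
  have H : (fun s => (rho \o delta) s * (s^-1 *: delta s)) @ 0^' --> (l * c : R) by exact: cvgM.
  suff E : {near 0^', (fun s => (rho \o delta) s * (s^-1 *: delta s))
     =1 (fun s : R => s^-1 *: (f (phi (s *: xi + w)) - f (phi w)))} by exact: cvg_trans (near_eq_cvg E) H.
  near=> s; rewrite /= mulrCA; congr (_ * _); rewrite /rho.
  have -> : phi (s *: xi + w) = t + delta s by rewrite /delta addrCA subrr addr0.
  case: eqP => [->|/eqP ds]; first by rewrite addr0 subrr mulr0.
  by rewrite /incr_ratio mulrC mulrA divff// mul1r.
split; first by apply/cvg_ex; exists (l * c).
exact: cvg_lim.
Unshelve. all: by end_near. Qed.

End HalfLine.

(** * Smooth bump functions *)

Section Bump.
Context {R : realType}.

(* The family is closed under derivation up to linear combinations, which makes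
   the smoothness of exp(-1/s) at 0 an induction. *)
Definition flat (k : nat) (s : R) : R :=
  if 0 < s then s^-1 ^+ k * expR (- s^-1) else 0.

Lemma flat_ge0 k s : 0 <= flat k s.
Proof.
rewrite /flat; case: ifP => // s0.
by rewrite mulr_ge0 ?expR_ge0// exprn_ge0// invr_ge0 ltW.
Qed.

(** With y = 1/s, the inequality y^(k+1) <= (k+1)! e^y gives s^(-k) e^(-1/s) <= (k+1)! s. The spare
    factor s is what makes the difference quotients at 0 tend to 0. *)
Lemma flat_bound k s : `|flat k s| <= k.+1`!%:R * `|s|.
Proof.
rewrite (ger0_norm (flat_ge0 k s)) /flat; case: ifP => [s0|_]; last by rewrite mulr_ge0.
have y0 : 0 < s^-1 by rewrite invr_gt0.
rewrite expRN ler_pdivrMr ?expR_gt0// (gtr0_norm s0).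
have := expR_ge1Dxn k (ltW y0); move=> H.
have {}H : s^-1 ^+ k.+1 <= k.+1`!%:R * expR s^-1.
  rewrite mulrC -ler_pdivrMr ?ltr0n ?fact_gt0//.
  by rewrite (le_trans _ H)// lerDr.
rewrite mulrAC -ler_pdivrMr//.
by rewrite mulrC -exprS.
Qed.

Lemma is_derive_flat k (s : R) :
  is_derive s 1 (flat k) (- k%:R * flat k.+1 s + flat k.+2 s).
Proof.
have [s0|s0|s0] := ltgtP s 0.
- rewrite /flat !ltNge (ltW s0) /= mulr0 addr0.
  apply: (near_eq_is_derive _ (is_derive_cst (0 : R) s 1)).
  near=> y; rewrite ifF//; apply/negbTE; rewrite -leNgt ltW//; near: y; exact: lt_nbhsl.
- have sn : s != 0 by rewrite gt_eqF.
  apply: (@near_eq_is_derive _ _ _ (fun y : R => y^-1 ^+ k * expR (- y^-1))).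
    near=> y; rewrite /flat ifT//; near: y; exact: lt_nbhsr.
  have d1 : is_derive s 1 (fun y : R => y^-1) (- s^-1 ^+ 2).
    split; first exact: derivableV.
    by rewrite (@deriveV _ _ id)// derive_id scaler1 exprVn.
  have d2 : is_derive s 1 (fun y : R => expR (- y^-1)) (s^-1 ^+ 2 * expR (- s^-1)).
    have dN : is_derive s 1 (fun y : R => - y^-1) (s^-1 ^+ 2).
      by have := is_deriveN d1; rewrite opprK; apply.
    by rewrite mulrC; exact: (is_derive1_comp (is_derive_expR _) dN).
  have d3 : is_derive s 1 (fun y : R => y^-1 ^+ k) (- k%:R * s^-1 ^+ k.+1).
    have := @is_deriveX R R (fun y : R => y^-1) k s 1 _ d1; rewrite exprfctE => H; apply: (is_derive_eq H).
    rewrite -[_ *: _]/(_ * _); case: (k) => [|j]; first by rewrite !mul0r oppr0 !mul0r.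
    by rewrite /= !exprS; ring.
  apply: (is_derive_eq (is_deriveM d3 d2)).
  rewrite -![_ *: _]/(_ * _) /flat s0 !exprS; ring.
- rewrite s0; have e j : flat j 0 = 0 by rewrite /flat ltxx.
  rewrite !e mulr0 addr0.
  have H : (fun h : R => h^-1 *: (flat k (h *: 1 + 0) - flat k 0)) @ 0^' --> (0 : R).
    apply/cvgrPdist_le => eps eps0; near=> h.
    have hn : h != 0 by near: h; exact: nbhs_dnbhs_neq.
    rewrite e subr0 addr0 [h *: 1]mulr1 sub0r normrN normrZ normfV.
    rewrite ler_pdivrMl ?normr_gt0//.
    have [h0|h0] := ltP 0 h; last first.
      by rewrite /flat ltNge h0 normr0 mulr_ge0// ltW.
    (* For positive [h] the difference quotient of [flat k] at 0 is thus [flat k.+1 h], to which the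
       linear bound applies. *)
    have -> : flat k h = h * flat k.+1 h.
      by rewrite /flat h0 exprS mulrA mulrA divff// mul1r.
    rewrite normrM ler_wpM2l// (le_trans (flat_bound _ _))//.
    rewrite -ler_pdivlMl ?ltr0n ?fact_gt0//; near: h; apply: dnbhs0_le.
    by rewrite mulr_gt0// invr_gt0 ltr0n fact_gt0.
  split; first by apply/cvg_ex; exists 0.
  exact: cvg_lim.
Unshelve. all: by end_near. Qed.

Lemma flat_mono (s t : R) : s <= t -> flat 0 s <= flat 0 t.
Proof.
move=> st; rewrite {1}/flat; case: ltP => [s0|_]; last exact: flat_ge0.
have t0 := lt_le_trans s0 st.
by rewrite /flat t0 !expr0 !mul1r ler_expR lerN2 lef_pV2.
Qed.

Lemma flat_gt0 k (s : R) : 0 < s -> 0 < flat k s.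
Proof. by move=> s0; rewrite /flat s0 mulr_gt0 ?expR_gt0// exprn_gt0// invr_gt0. Qed.

Lemma flat_le0 k (s : R) : s <= 0 -> flat k s = 0.
Proof. by move=> s0; rewrite /flat ltNge s0. Qed.

(** The index [j] is generalised in the induction on [k], since each derivative raises it by one and
    by two. *)
Lemma Ck_flat n (U : set 'rV[R]_n) k j (g : 'rV[R]_n -> R) :
  open U -> Ck U k g -> Ck U k (fun x => flat j (g x)).
Proof.
move=> oU; elim: k j g => [|k IH] j g Cg; have dc x : U x -> differentiable (fun x => flat j (g x)) x.
- move=> Ux; apply: (@differentiable_comp _ _ _ _ g (flat j)); first exact: (CkD Cg).
  by apply/derivable1_diffP; have [] := is_derive_flat j (g x).
- by split.
- move=> Ux; apply: (@differentiable_comp _ _ _ _ g (flat j)); first exact: (CkD Cg).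
  by apply/derivable1_diffP; have [] := is_derive_flat j (g x).
split=> // v; have [_ /(_ v) Dg] := Cg.
have C1 := Ck_scale oU (Ck_cst k (- j%:R : R) oU) (IH j.+1 _ (CkS Cg)).
have := Ck_scale oU (CkDD oU C1 (IH j.+2 _ (CkS Cg))) Dg.
apply: Ck_eq => // x Ux.
have df : differentiable (flat j) (g x).
  by apply/derivable1_diffP; have [] := is_derive_flat j (g x).
have [_ E] := is_derive_flat j (g x).
rewrite (derive_comp _ (CkD Cg Ux) df) -[in RHS](mulr1 ('D_v g x)).
by rewrite -[_ * 1]/(_ *: 1) deriveZv// E -[LHS]/(_ * _) mulrC.
Qed.

Lemma bump_exists n (c : 'rV[R]_n) (r : R) : 0 < r ->
  exists beta : 'rV[R]_n -> R, [/\ forall k, Ck setT k beta,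
    (\near c, beta c = 1) & forall x, beta x != 0 -> `|x - c| <= r].
Proof.
move=> r0.
(* A sum of squares, because the norm on row vectors is a maximum and not smooth. The factor makes
   [S x < 2] equivalent to the sum being below [r ^+ 2], which bounds each entry by [r]. *)
pose S (x : 'rV[R]_n) := (2 / r ^+ 2) * \sum_j (x 0 j - c 0 j) ^+ 2.
have oT : open (@setT 'rV[R]_n) by exact: openT.
have CS k : Ck setT k S.
  have Cid : Ck setT k (@idfun 'rV[R]_n) by apply: Ck_linear => // x.
  have Cj j : Ck setT k (fun x : 'rV[R]_n => x 0 j - c 0 j).
    exact: CkDD (Ck_entry j oT Cid) (Ck_cst k (- c 0 j) oT).
  exact: Ck_scale oT (Ck_cst k _ oT) (Ck_sum oT (fun j => Ck_scale oT (Cj j) (Cj j))).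
pose top := flat 0 1.
(* [flat 0 (S - 1)] vanishes where [S <= 1] and is at least [top] where [2 <= S]. *)
exists (fun x => (flat 0 top)^-1 * flat 0 (top - flat 0 (S x - 1))).
have top0 : 0 < top by exact: flat_gt0.
split.
- move=> k; apply: (Ck_scale oT (Ck_cst k _ oT)); apply: Ck_flat => //.
  apply: (CkDD oT (Ck_cst k _ oT)).
  have C1 := @Ck_flat n setT k 0 (fun x => S x - 1) oT (CkDD oT (CS k) (Ck_cst k (-1 : R) oT)).
  by apply: (Ck_eq oT _ (Ck_scale oT (Ck_cst k (-1 : R) oT) C1)) => x _; rewrite -[LHS]/(_ * _) mulN1r.
- have Sc : S c = 0 by rewrite /S big1 ?mulr0// => j _; rewrite subrr expr0n.
  have : S x @[x --> c] --> (0 : R).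
    by rewrite -Sc; apply: differentiable_continuous; exact: (CkD (CS 0%N)).
  move=> /cvgrPdist_lt/(_ 1 ltr01); apply: filterS => x.
  rewrite sub0r normrN => /(le_lt_trans (ler_norm _)) Sx.
  rewrite (@flat_le0 0%N (S x - 1)) ?subr0 ?subr_le0 ?ltW// mulVf// gt_eqF//.
  exact: flat_gt0.
- move=> x bx; have Sx : S x < 2.
    rewrite ltNge; apply: contra bx => Sx.
    rewrite (@flat_le0 0%N (top - _)) ?mulr0// subr_le0; apply: flat_mono.
    by rewrite lerBrDr.
  rewrite [leLHS]/Num.Def.normr/= mx_normrE; apply: bigmax_le => [|[i j] _]; first exact: ltW.
  rewrite !mxE /= !ord1 -(ler_pXn2r (ltn0Sn 1))// ?nnegrE ?normr_ge0 ?ltW// real_normK ?num_real//.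
  have : (x 0 j - c 0 j) ^+ 2 <= \sum_j (x 0 j - c 0 j) ^+ 2.
    by rewrite (bigD1 j)//= lerDl sumr_ge0// => i' _; exact: sqr_ge0.
  move/le_lt_trans; apply; move: Sx.
  by rewrite /S mulrAC ltr_pdivrMr ?exprn_gt0// ltr_pM2l.
Unshelve. all: by end_near. Qed.

End Bump.

(** In [bracketE], [a] and [c] are the second derivatives of the transition map taken in the two
    orders. *)
Lemma subr_cancel (V : zmodType) (a b c d : V) : a = c -> b - d = (a + b) - (c + d).
Proof. by move=> ->; rewrite opprD addrACA subrr add0r. Qed.

Local Opaque derive.

(** * Charts and transition maps *)

Section Charts.
Context {R : realType} {n : nat} (M : charted R n).
Hypothesis HM : manifold M.
Local Notation crd := (@Defs.coord R n M).
Local Notation par := (@param R n M).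
Implicit Types (i j k : Defs.index M) (p q : M) (x y v w : 'rV[R]_n).

Definition chart_image i : set 'rV[R]_n := crd i @` dom i.
Definition overlap i j : set 'rV[R]_n := crd i @` (dom i `&` dom j).
Definition transition i j x : 'rV[R]_n := crd j (par i x).
(** The inverse of [tcoord i] at the point with coordinates [x]: it leads from the components in
    chart [i] back to those in the preferred chart, as [tinvK] and [tcoordK] confirm. *)
Definition tinv i x v : 'rV[R]_n := 'D_v (transition i (pref (par i x))) x.

Lemma pref_dom p : dom (pref p) p. Proof. by case: HM. Qed.

Lemma param_coord i p : dom i p -> par i (crd i p) = p.
Proof. by case: HM => _ + _ _ _; exact. Qed.

Lemma open_overlap i j : open (overlap i j).
Proof. by case: HM => _ _ + _ _; apply. Qed.

Lemma Ck_transition i j (k : nat) : Ck (overlap i j) k (transition i j).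
Proof. by case: HM => _ _ _ /(_ i j) /smooth_onP + _; apply. Qed.

Lemma open_chart_image i : open (chart_image i).
Proof. by have := @open_overlap i i; rewrite /overlap setIid. Qed.

Lemma chart_imageP i x : chart_image i x -> dom i (par i x) /\ crd i (par i x) = x.
Proof. by move=> [p ip <-]; rewrite param_coord. Qed.

Lemma dom_image i p : dom i p -> chart_image i (crd i p).
Proof. by move=> ip; exists p. Qed.

Lemma overlapP i j x : overlap i j x <-> chart_image i x /\ dom j (par i x).
Proof.
split=> [[p [ip jp] <-]|[[p ip <-]]]; rewrite param_coord//.
  by split=> //; exists p.
by move=> jp; exists p.
Qed.

Lemma dom_overlap i j p : dom i p -> dom j p -> overlap i j (crd i p).
Proof. by move=> ip jp; exists p. Qed.

Lemma overlap_sym i j x : overlap i j x -> overlap j i (transition i j x).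
Proof. by move=> [p [ip jp] <-]; rewrite /transition param_coord//; exists p. Qed.

Lemma transition_coord i j p : dom i p -> transition i j (crd i p) = crd j p.
Proof. by move=> ip; rewrite /transition param_coord. Qed.

Lemma param_transition i j x : overlap i j x -> par j (transition i j x) = par i x.
Proof. by move=> [p [ip jp] <-]; rewrite /transition !param_coord. Qed.

Lemma transition_comp i j k x : overlap i j x ->
  transition j k (transition i j x) = transition i k x.
Proof. by move=> ijx; rewrite {1}/transition param_transition. Qed.

Lemma differentiable_transition i j x : overlap i j x -> differentiable (transition i j) x.
Proof. exact: CkD (Ck_transition i j 0). Qed.

Lemma near_overlap i j x : overlap i j x -> \near x, overlap i j x.
Proof. by move=> ijx; apply: (open_nbhs_nbhs (conj (@open_overlap i j) ijx)). Qed.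

(** The cocycle identity of transition maps holds near [x] because overlaps are open, and can
    therefore be differentiated. *)
Lemma derive_transition_comp i j k x v : overlap i j x -> overlap i k x ->
  'D_('D_v (transition i j) x) (transition j k) (transition i j x) = 'D_v (transition i k) x.
Proof.
move=> ijx ikx; rewrite -derive_comp; last 2 first.
- exact: differentiable_transition.
- apply: differentiable_transition; apply/overlapP; rewrite param_transition//; split.
    by have /overlapP[] := overlap_sym ijx.
  by have /overlapP[] := ikx.
apply: near_eq_derive; apply: filterS (near_overlap ijx) => y; exact: transition_comp.
Qed.

Lemma derive_transition_id i x v : chart_image i x -> 'D_v (transition i i) x = v.
Proof.
move=> ix; rewrite -[RHS](derive_id x); apply: near_eq_derive.
apply: filterS (open_nbhs_nbhs (conj (@open_chart_image i) ix)) => y iy.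
by have [_ e] := chart_imageP iy; rewrite /transition e.
Qed.

Lemma tcoordE i p v : tcoord i p v = 'D_v (transition (pref p) i) (crd (pref p) p).
Proof. by []. Qed.

Lemma tcoord_pref p v : tcoord (pref p) p v = v.
Proof. by rewrite tcoordE derive_transition_id//; exact/dom_image/pref_dom. Qed.

Lemma tcoord_change i j p v : dom i p -> dom j p ->
  tcoord j p v = 'D_(tcoord i p v) (transition i j) (crd i p).
Proof.
move=> ip jp; have pp := pref_dom p.
rewrite !tcoordE -(derive_transition_comp v (dom_overlap pp ip) (dom_overlap pp jp)).
by rewrite transition_coord.
Qed.

Lemma tinv_coord i p v : dom i p -> tinv i (crd i p) v = 'D_v (transition i (pref p)) (crd i p).
Proof. by move=> ip; rewrite /tinv param_coord. Qed.

Lemma tinvK i p v : dom i p -> tcoord i p (tinv i (crd i p) v) = v.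
Proof.
move=> ip; have pp := pref_dom p; rewrite tinv_coord// tcoordE.
rewrite -(transition_coord (pref p) ip) derive_transition_comp.
- by rewrite derive_transition_id//; exact: dom_image.
- exact: dom_overlap.
- exact: dom_overlap.
Qed.

Lemma tcoordK i p v : dom i p -> tinv i (crd i p) (tcoord i p v) = v.
Proof.
by move=> ip; rewrite tinv_coord// -tcoord_change ?tcoord_pref//; exact: pref_dom.
Qed.

Lemma lin_tcoord i p : dom i p -> lin (tcoord i p).
Proof.
move=> ip; apply: lin_derive; apply: differentiable_transition.
exact: dom_overlap (pref_dom p) ip.
Qed.

Lemma lin_tinv i x : chart_image i x -> lin (tinv i x).
Proof.
move=> [p ip <-] c u v; rewrite !tinv_coord//.
apply: lin_derive; apply: differentiable_transition.
exact: dom_overlap ip (pref_dom p).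
Qed.

Lemma field_coordE X i p : dom i p -> field_coord X i (crd i p) = tcoord i p (X p).
Proof. by move=> ip; rewrite /field_coord param_coord. Qed.

Lemma field_coord_pref X p : field_coord X (pref p) (crd (pref p) p) = X p.
Proof. by rewrite field_coordE ?tcoord_pref//; exact: pref_dom. Qed.

Lemma field_coord_change X i j x : overlap i j x ->
  field_coord X j (transition i j x) = 'D_(field_coord X i x) (transition i j) x.
Proof.
move=> [p [ip jp] <-]; rewrite (transition_coord _ ip) (field_coordE _ ip) (field_coordE _ jp).
exact: tcoord_change.
Qed.

(** Frees the derivative of a function along a field from the preferred chart of the point: by the
    chain rule any chart around it gives the same value. *)
Lemma field_derivE X (f : M -> R) i p : dom i p ->
  differentiable (f \o par i) (crd i p) ->
  field_deriv X f p = 'D_(field_coord X i (crd i p)) (f \o par i) (crd i p).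
Proof.
move=> ip df; have pp := pref_dom p; have o := dom_overlap pp ip.
rewrite (field_coordE _ ip) tcoordE /field_deriv -(transition_coord i pp).
rewrite -derive_comp; last 2 first.
- exact: differentiable_transition.
- by rewrite transition_coord.
apply: near_eq_derive; apply: filterS (near_overlap o) => y oy /=.
by rewrite param_transition.
Qed.

Lemma smooth_fieldP X : smooth_field X <-> forall i (k : nat), Ck (chart_image i) k (field_coord X i).
Proof.
split=> [H i k|H i]; first by have /smooth_onP := H i; exact.
by apply/smooth_onP => k; exact: H.
Qed.

Lemma differentiable_field X i x : smooth_field X -> chart_image i x ->
  differentiable (field_coord X i) x.
Proof. by move=> /smooth_fieldP/(_ i 0%N) CX; exact: CkD CX. Qed.

(** Changing charts adds to each half of the bracket a second derivative of the transition map; the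
    two additions agree by symmetry and cancel. *)
Lemma bracketE X Y i p : smooth_field X -> smooth_field Y -> dom i p ->
  tcoord i p (bracket X Y p) =
  'D_(field_coord X i (crd i p)) (field_coord Y i) (crd i p)
  - 'D_(field_coord Y i (crd i p)) (field_coord X i) (crd i p).
Proof.
move=> sX sY ip; set j := pref p; have jp : dom j p := pref_dom p.
have o := dom_overlap jp ip; set y := crd j p in o *.
have ix := dom_image ip; have jy : chart_image j y := dom_image jp.
have dt : differentiable (transition j i) y by exact: differentiable_transition.
(* Near the point, [W] in chart [i] is the image of [W] in chart [j] under the derivative of the
   transition map, a linear family at a moving vector. *)
have key Z W : smooth_field Z -> smooth_field W ->
   'D_(field_coord Z i (crd i p)) (field_coord W i) (crd i p) =
   'D_(field_coord Z j y) ('D_(field_coord W j y) (transition j i)) y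
   + 'D_('D_(field_coord Z j y) (field_coord W j) y) (transition j i) y.
  move=> sZ sW; rewrite -(transition_coord i jp) (field_coord_change _ o).
  rewrite -(derive_comp _ dt); last by rewrite transition_coord//; exact: differentiable_field.
  rewrite (@near_eq_derive _ _ _ _
    (fun y' => 'D_(field_coord W j y') (transition j i) y')); last first.
    by apply: filterS (near_overlap o) => y' oy; exact: field_coord_change.
  apply: (@derive_family _ _ _ _ (fun y' v => 'D_v (transition j i) y')) => [|v|].
  - by apply: filterS (near_overlap o) => y' oy; apply: lin_derive; exact: differentiable_transition.
  - by have [_ /(_ v) [C _]] := Ck_transition j i 1; exact: C.
  - exact: differentiable_field.
rewrite (key X Y sX sY) (key Y X sY sX) tcoordE /bracket -/j -/y.
rewrite (deriveBv _ _ dt) !field_coord_pref.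
apply: subr_cancel.
exact: (derive_comm_rV (Y p) (X p) (@open_overlap j i) o (Ck_transition j i 1)).
Qed.

End Charts.

Arguments open_chart_image {R n M} HM i.
Arguments open_overlap {R n M} HM i j.

(** * Extension by zero of fields and functions given in a chart *)

Section Gluing.
Context {R : realType} {n : nat} (M : charted R n).
Hypothesis HM : manifold M.
Local Notation crd := (@Defs.coord R n M).
Local Notation par := (@param R n M).
Implicit Types (i j : Defs.index M) (p q : M) (x y v w : 'rV[R]_n).

(** Continuity of a parametrisation for the topology generated by all charts: subbasic sets pull
    back to open sets because transition maps are continuous. *)
Lemma open_param i (A : set (mspace M)) : open A ->
  open [set x | chart_image i x /\ A (par i x)].
Proof.
(* An open set is a union, indexed by [D'], of finite intersections of subbasic sets; the finitely
   many members of [F] are treated one by one. *)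
move=> [D' sD' <-]; rewrite openE => x [ix [B D'B Bx]].
have [F sF BE] := sD' _ D'B; rewrite -BE in Bx.
suff : nbhs x (\bigcap_(b in [set` F]) [set y | chart_image i y /\ (b : set (mspace M)) (par i y)]).
  move=> nB; have oi : nbhs x (chart_image i).
    exact: open_nbhs_nbhs (conj (open_chart_image HM i) ix).
  apply: (filterS _ (filterI nB oi)) => y [Fy iy]; split=> //; exists B; first exact: D'B.
  suff H : (\bigcap_(b in [set` F]) (b : set (mspace M))) (par i y) by rewrite -BE; exact: H.
  by move=> b Fb; have [_ H] := Fy b Fb; exact: H.
have {}Bx : (\bigcap_(b in [set` F]) (b : set (mspace M))) (par i x) by exact: Bx.
apply: filter_bigI => b Fb; have bx := Bx b Fb.
have := set_mem (sF b Fb); move=> -[j [S [oS bE]]]; rewrite bE in bx *.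
have [jx Sx] := bx; have ijx : overlap i j x by apply/overlapP.
have ct : transition i j @ x --> transition i j x.
  by apply: differentiable_continuous; exact: differentiable_transition.
apply: (filterS _ (filterI (near_overlap HM ijx) (ct _ (open_nbhs_nbhs (conj oS Sx))))).
by move=> y [/(overlapP HM)[iy jy] Oy].
Qed.

(** Here the Hausdorff axiom enters: the continuous image of a compact set is compact, hence
    closed. *)
Lemma closed_param i (K : set 'rV[R]_n) : compact K -> K `<=` chart_image i ->
  closed (par i @` K : set (mspace M)).
Proof.
move=> cK Ki; have [hM _] : hausdorff_space (mspace M) /\ @second_countable (mspace M).
  by case: HM.
apply: compact_closed => //; apply: continuous_compact => //.
apply: continuous_in_subspaceT => x /set_mem Kx A; rewrite nbhsE => -[B [oB Bx] BA].
have ox := @open_param i _ oB.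
by apply: filterS (open_nbhs_nbhs (conj ox (conj (Ki _ Kx) Bx))) => y [_ By]; exact: BA.
Qed.

(** [tinv] is needed because the value at [q] must be expressed in the preferred chart of [q], not
    in chart [i]. *)
Definition glue_field i (h : 'rV[R]_n -> 'rV[R]_n) (q : M) : 'rV[R]_n :=
  if `[< dom i q >] then tinv i (crd i q) (h (crd i q)) else 0.

Definition glue_fun i (h : 'rV[R]_n -> R) (q : M) : R :=
  if `[< dom i q >] then h (crd i q) else 0.

Lemma field_coord_glue i h x : chart_image i x -> field_coord (glue_field i h) i x = h x.
Proof.
move=> [p ip <-]; rewrite (field_coordE HM _ ip) /glue_field asboolT//.
exact: tinvK.
Qed.

(** A point outside chart [i] may be a limit of points of that chart, but not of points of [K],
    whose image is closed. This is what makes extension by zero smooth at the edge of the chart. *)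
Lemma near_off_support i j (K : set 'rV[R]_n) y : compact K -> K `<=` chart_image i ->
  chart_image j y -> ~ dom i (par j y) ->
  exists2 N, open_nbhs y N &
    forall z, N z -> chart_image j z /\ (dom i (par j z) -> ~ K (crd i (par j z))).
Proof.
move=> cK Ki jy niy; have cl := closed_param cK Ki.
exists [set z | chart_image j z /\ (~` (par i @` K)) (par j z)].
  split; first exact: (open_param (closed_openC cl)).
  by split=> // -[x /Ki[p ip <-]]; rewrite (param_coord HM ip) => e; apply: niy; rewrite -e.
move=> z [jz nz]; split=> // iz Kz; apply: nz.
by exists (crd i (par j z)) => //; rewrite (param_coord HM iz).
Qed.

(** Near a point of [dom i] the field is the transform of [h] by transition maps; near any other
    point it is zero by [near_off_support]. *)
Lemma smooth_glue_field i (K : set 'rV[R]_n) h : compact K -> K `<=` chart_image i ->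
  (forall k, Ck (chart_image i) k h) -> (forall x, chart_image i x -> ~ K x -> h x = 0) ->
  smooth_field (glue_field i h).
Proof.
move=> cK Ki Ch h0; apply/(smooth_fieldP) => j k; apply: Ck_local => y jy.
have [iy|niy] := pselect (dom i (par j y)).
  have jiy : overlap j i y by apply/overlapP.
  exists (overlap j i); first exact: near_overlap.
  have oji := open_overlap HM j i.
  have C1 : Ck (overlap j i) k (fun z => h (transition j i z)).
    apply: (Ck_comp oji (Ck_transition HM j i k) (Ch k)) => z /(overlap_sym HM).
    by move/(overlapP HM) => [].
  have C2 : forall v, Ck (overlap j i) k (fun z => 'D_v (transition i j) (transition j i z)).
    move=> v; have [_ /(_ v) C] := Ck_transition HM i j k.+1.
    by apply: (Ck_comp oji (Ck_transition HM j i k) C) => z; exact: overlap_sym.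
  apply: (Ck_eq oji _ (Ck_family oji _ C2 C1)) => z jiz.
    rewrite -{1}(@field_coord_glue i h); last by have /(overlapP HM)[] := overlap_sym HM jiz.
    rewrite -(field_coord_change HM _ (overlap_sym HM jiz)).
    rewrite (transition_comp HM _ jiz); congr field_coord.
    have /(overlapP HM)[jz _] := jiz.
    by have [] := chart_imageP HM jz.
  apply: lin_derive; apply: differentiable_transition => //; exact: overlap_sym.
have [N [oN Ny] HN] := near_off_support cK Ki jy niy.
exists N; first exact: open_nbhs_nbhs.
apply: (Ck_eq oN _ (Ck_cst k 0 oN)) => z /HN [jz nK].
have [dj ez] := chart_imageP HM jz.
rewrite /field_coord /glue_field; have t0 : tcoord j (par j z) 0 = 0.
  exact: lin0 (lin_tcoord HM dj).
case: asboolP => [iz|_]; last by rewrite t0.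
by have ci := dom_image iz; rewrite (h0 _ ci (nK iz)) (lin0 (lin_tinv HM ci)) t0.
Qed.

Lemma smooth_glue_fun i (K : set 'rV[R]_n) h : compact K -> K `<=` chart_image i ->
  (forall k, Ck (chart_image i) k h) -> (forall x, chart_image i x -> ~ K x -> h x = 0) ->
  smooth_fun (glue_fun i h).
Proof.
move=> cK Ki Ch h0 j; apply/smooth_onP => k; apply: Ck_local => y jy.
have [iy|niy] := pselect (dom i (par j y)).
  have jiy : overlap j i y by apply/overlapP.
  exists (overlap j i); first exact: near_overlap.
  have oji := open_overlap HM j i.
  have C1 : Ck (overlap j i) k (fun z => h (transition j i z)).
    apply: (Ck_comp oji (Ck_transition HM j i k) (Ch k)) => z /(overlap_sym HM).
    by move/(overlapP HM) => [].
  apply: (Ck_eq oji _ C1) => z /(overlapP HM)[_ iz].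
  by rewrite /= /glue_fun asboolT.
have [N [oN Ny] HN] := near_off_support cK Ki jy niy.
exists N; first exact: open_nbhs_nbhs.
apply: (Ck_eq oN _ (Ck_cst k 0 oN)) => z /HN [jz nK].
rewrite /= /glue_fun; case: asboolP => [iz|//].
by rewrite h0//; [exact: dom_image|exact: nK].
Qed.

Lemma chart_bump i x : chart_image i x ->
  exists (beta : 'rV[R]_n -> R) (K : set 'rV[R]_n),
  [/\ compact K, K `<=` chart_image i, forall k, Ck setT k beta,
      (\near x, beta x = 1) & forall y, ~ K y -> beta y = 0].
Proof.
move=> ix; have /nbhs_normP[r /= r0 ri] := open_nbhs_nbhs (conj (open_chart_image HM i) ix).
have r20 : 0 < r / 2 by rewrite divr_gt0.
have [beta [C1 C2 C3]] := bump_exists x r20.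
exists beta, (closed_ball x (r / 2)); split=> //.
- apply: bounded_closed_compact; last exact: closed_ball_closed.
  rewrite /= /bounded_near; near=> B; move=> y /=; rewrite closed_ballE// => yx.
  rewrite -(subrK x y) (le_trans (ler_normD _ _))//.
  have : `|y - x| + `|x| <= r / 2 + `|x| by rewrite lerD2r distrC.
  by move/le_trans; apply; near: B; apply: nbhs_pinfty_ge; exact: num_real.
- move=> y; rewrite closed_ballE// => yx; apply: ri; rewrite /ball_ /=.
  by rewrite (le_lt_trans yx)// ltr_pdivrMr// ltr_pMr// ltrDl.
- move=> y; rewrite closed_ballE// => yx; apply/eqP; apply: contrapT => /negP/C3.
  by rewrite distrC.
Unshelve. all: by end_near. Qed.

(** [extend] selects among the smooth fields with the given value and falls back on 0 if there is
    none; a constant field multiplied by a bump function shows that there is one. *)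
Lemma extendP p v : smooth_field (extend p v : M -> _) /\ extend p v p = v.
Proof.
set i := pref p; have ip : dom i p := pref_dom HM p.
have [beta [K [cK Ki Cb nb b0]]] := chart_bump (dom_image ip).
suff : [set X : M -> 'rV[R]_n | smooth_field X /\ X p = v] (extend p v) by [].
apply: (@xgetI _ _ _ (glue_field i (fun x => beta x *: v))); split.
  apply: (smooth_glue_field cK Ki) => [k|x _ /b0 ->]; last by rewrite scale0r.
  apply: Ck_scale (Ck_cst _ _ (open_chart_image HM i)); first exact: open_chart_image.
  by apply: (Ck_subset (U := setT)).
rewrite -[LHS](field_coord_pref HM) field_coord_glue; last exact: dom_image.
by rewrite (nbhs_singleton nb) scale1r.
Qed.

End Gluing.
Local Opaque derive field_coord tcoord tinv transition field_deriv bracket smooth_field smooth_fun.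

(** * Connections in a local frame *)

Section Connections.
Context {R : realType} {n : nat} (M : charted R n).
Hypothesis HM : manifold M.
Local Notation crd := (@Defs.coord R n M).
Local Notation par := (@param R n M).
Implicit Types (i : Defs.index M) (p q : M) (x y v w : 'rV[R]_n).
Implicit Types (X Y Z : M -> 'rV[R]_n).

Lemma smooth_cst (c : R) : @smooth_fun R n M (fun=> c).
Proof. by move=> i; apply/smooth_onP => k; exact: Ck_cst (open_chart_image HM i). Qed.

Lemma field_coord_scaleD (f : M -> R) X X' i x : chart_image i x ->
  field_coord (fun q => f q *: X q + X' q) i x
  = f (par i x) *: field_coord X i x + field_coord X' i x.
Proof. by move=> [p ip <-]; rewrite !(field_coordE HM _ ip) (lin_tcoord HM ip) (param_coord HM ip). Qed.

Lemma smooth_field_scaleD (f : M -> R) X X' : smooth_fun f -> smooth_field X ->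
  smooth_field X' -> smooth_field (fun q => f q *: X q + X' q).
Proof.
move=> sf /smooth_fieldP sX /smooth_fieldP sX'; apply/smooth_fieldP => i k.
have oi := open_chart_image HM i.
have := CkDD oi (Ck_scale oi ((smooth_onP _ _).1 (sf i) k) (sX i k)) (sX' i k).
by apply: Ck_eq => // x ix; rewrite field_coord_scaleD.
Qed.

Lemma smooth_field0 : @smooth_field R n M (fun=> 0).
Proof.
apply/smooth_fieldP => i k; have oi := open_chart_image HM i.
apply: (Ck_eq oi _ (Ck_cst k 0 oi)) => _ [p ip <-].
by rewrite (field_coordE HM _ ip) (lin0 (lin_tcoord HM ip)).
Qed.

Lemma smooth_field_scale (f : M -> R) X : smooth_fun f -> smooth_field X ->
  smooth_field (fun q => f q *: X q).
Proof.
move=> sf sX; have := smooth_field_scaleD sf sX smooth_field0.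
by congr smooth_field; apply/funext => q; rewrite addr0.
Qed.

Lemma smooth_fieldB X Y : smooth_field X -> smooth_field Y -> smooth_field (fun q => X q - Y q).
Proof.
move=> sX sY; have := smooth_field_scaleD (smooth_cst (-1)) sY sX.
by congr smooth_field; apply/funext => q; rewrite scaleN1r addrC.
Qed.

Lemma smooth_field_sum m (f : 'I_m -> M -> R) (X : 'I_m -> M -> 'rV[R]_n) :
  (forall j, smooth_fun (f j)) -> (forall j, smooth_field (X j)) ->
  smooth_field (fun q => \sum_j f j q *: X j q).
Proof.
elim: m f X => [|m IH] f X sf sX.
  by have := smooth_field0; congr smooth_field; apply/funext => q; rewrite big_ord0.
have := smooth_field_scaleD (sf ord0) (sX ord0)
  (IH (fun j => f (lift ord0 j)) (fun j => X (lift ord0 j)) (fun j => sf _) (fun j => sX _)).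
by congr smooth_field; apply/funext => q; rewrite big_ord_recl.
Qed.

Lemma smooth_funM (f h : M -> R) : smooth_fun f -> smooth_fun h -> smooth_fun (fun q => f q * h q).
Proof.
move=> sf sh i; apply/smooth_onP => k; have oi := open_chart_image HM i.
exact: (Ck_scale oi ((smooth_onP _ _).1 (sf i) k) ((smooth_onP _ _).1 (sh i) k)).
Qed.

Lemma differentiable_smooth_fun (f : M -> R) i x : smooth_fun f -> chart_image i x ->
  differentiable (f \o par i) x.
Proof. by move=> sf; exact: CkD ((smooth_onP _ _).1 (sf i) 0%N). Qed.

Lemma field_deriv_near_cst X (f : M -> R) c i x : chart_image i x ->
  (\near x, f (par i x) = c) -> field_deriv X f (par i x) = 0.
Proof.
move=> [p ip <-]; rewrite (param_coord HM ip) => fc.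
have fc' : \forall y \near crd i p, cst c y = (f \o par i) y.
  by apply: filterS fc => y /= ->.
rewrite (field_derivE HM _ ip); last by apply: (near_eq_differentiable fc'); exact: differentiable_cst.
by rewrite -(near_eq_derive _ fc') derive_cst.
Qed.

Variable nabla : (M -> 'rV[R]_n) -> (M -> 'rV[R]_n) -> M -> 'rV[R]_n.
Hypothesis Cn : connection nabla.

Lemma nabla_smooth X Y : smooth_field X -> smooth_field Y -> smooth_field (nabla X Y).
Proof. by case: Cn => + _ _ _; apply. Qed.

(** The linearity axiom with coefficient 1 and zero fields reads a = a + a. *)
Lemma nabla0l Y p : smooth_field Y -> nabla (fun=> 0) Y p = 0.
Proof.
move=> sY; case: Cn => _ Cl _ _.
have := Cl (fun=> 1) (fun=> 0) (fun=> 0) Y (smooth_cst 1) smooth_field0 smooth_field0 sY p.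
have -> : (fun q : M => 1 *: (0 : 'rV[R]_n) + 0) = fun=> 0.
  by apply/funext => q; rewrite scaler0 addr0.
by rewrite scale1r => /eqP; rewrite -subr_eq0 opprD addrA subrr add0r oppr_eq0 => /eqP.
Qed.

Lemma nabla_suml m (f : 'I_m -> M -> R) (X : 'I_m -> M -> 'rV[R]_n) Y p :
  (forall j, smooth_fun (f j)) -> (forall j, smooth_field (X j)) -> smooth_field Y ->
  nabla (fun q => \sum_j f j q *: X j q) Y p = \sum_j f j p *: nabla (X j) Y p.
Proof.
move=> + + sY; elim: m f X => [|m IH] f X sf sX.
  rewrite big_ord0 -[RHS](nabla0l p sY); congr nabla.
  by apply/funext => q; rewrite big_ord0.
rewrite big_ord_recl.
rewrite -(IH (fun j => f (lift ord0 j)) (fun j => X (lift ord0 j)) (fun=> sf _) (fun=> sX _)).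
have sS := smooth_field_sum (fun j => sf (lift ord0 j)) (fun j => sX (lift ord0 j)).
case: Cn => _ Cl _ _; rewrite -(Cl _ _ _ _ (sf ord0) (sX ord0) sS sY).
by congr nabla; apply/funext => q; rewrite big_ord_recl.
Qed.

Lemma nabla_scalel (f : M -> R) X Y p : smooth_fun f -> smooth_field X -> smooth_field Y ->
  nabla (fun q => f q *: X q) Y p = f p *: nabla X Y p.
Proof.
move=> sf sX sY.
have := @nabla_suml 1 (fun=> f) (fun=> X) Y p (fun=> sf) (fun=> sX) sY.
rewrite big_ord1 => <-; congr nabla.
by apply/funext => q; rewrite big_ord1.
Qed.

Lemma nabla_sumr m (f : 'I_m -> M -> R) (Y : 'I_m -> M -> 'rV[R]_n) X p :
  (forall j, smooth_fun (f j)) -> (forall j, smooth_field (Y j)) -> smooth_field X ->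
  nabla X (fun q => \sum_j f j q *: Y j q) p
  = \sum_j (field_deriv X (f j) p *: Y j p + f j p *: nabla X (Y j) p).
Proof.
move=> + + sX; case: Cn => _ _ CD CM; elim: m f Y => [|m IH] f Y sf sY.
  rewrite big_ord0; have := CD X _ _ sX smooth_field0 smooth_field0 p.
  have -> : (fun q : M => (0 : 'rV[R]_n) + 0) = fun=> 0 by apply/funext => q; rewrite addr0.
  move=> /eqP; rewrite -subr_eq0 opprD addrA subrr add0r oppr_eq0 => /eqP e0; rewrite -[RHS]e0; congr nabla.
  by apply/funext => q; rewrite big_ord0.
rewrite big_ord_recl.
rewrite -(IH (fun j => f (lift ord0 j)) (fun j => Y (lift ord0 j)) (fun=> sf _) (fun=> sY _)).
have s0 := smooth_field_scale (sf ord0) (sY ord0).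
have sS := smooth_field_sum (fun j => sf (lift ord0 j)) (fun j => sY (lift ord0 j)).
rewrite -(CM _ _ _ (sf ord0) sX (sY ord0)) -(CD _ _ _ sX s0 sS).
by congr nabla; apply/funext => q; rewrite big_ord_recl.
Qed.

Lemma lin_nablar X p (E : 'rV[R]_n -> M -> 'rV[R]_n) :
  smooth_field X -> (forall v, smooth_field (E v)) -> (forall q, lin (E ^~ q)) ->
  lin (fun v => nabla X (E v) p).
Proof.
move=> sX sE lE c v w; case: Cn => _ _ CD CM.
have -> : E (c *: v + w) = fun q => c *: E v q + E w q by apply/funext => q; rewrite lE.
have sc := smooth_cst c.
rewrite (CD X _ (E w) sX (smooth_field_scale sc (sE v)) (sE w) p).
rewrite (CM _ X (E v) sc sX (sE v) p).
have -> : field_deriv X (fun=> c) p = 0.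
  by rewrite -(derive_cst c (crd (pref p) p) (X p)).
by rewrite scale0r add0r.
Qed.

Lemma lin_nablal Y p (E : 'rV[R]_n -> M -> 'rV[R]_n) :
  smooth_field Y -> (forall v, smooth_field (E v)) -> (forall q, lin (E ^~ q)) ->
  lin (fun v => nabla (E v) Y p).
Proof.
move=> sY sE lE c v w; case: Cn => _ Cl _ _.
have -> : E (c *: v + w) = fun q => c *: E v q + E w q by apply/funext => q; rewrite lE.
by rewrite (Cl _ (E v) (E w) Y (smooth_cst c) (sE v) (sE w) sY p).
Qed.

Lemma lin_field_coord i x (F : 'rV[R]_n -> M -> 'rV[R]_n) : chart_image i x ->
  (forall q, lin (F ^~ q)) -> lin (fun v => field_coord (F v) i x).
Proof.
move=> [p ip <-] lF c v w.
by rewrite !(field_coordE HM _ ip) (lF p c v w) (lin_tcoord HM ip).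
Qed.

(** All that later computations know of the connection near a point: global fields that look
    constant in the chart on [N], and a smooth bilinear Christoffel map. No bump function remains
    visible. *)
Record local_frame i (N : set 'rV[R]_n) (E : 'rV[R]_n -> M -> 'rV[R]_n)
    (Gamma : 'rV[R]_n -> 'rV[R]_n -> 'rV[R]_n -> 'rV[R]_n) : Prop := LocalFrame {
  lf_open : open N;
  lf_sub : forall x, N x -> chart_image i x;
  lf_smooth : forall v, smooth_field (E v);
  lf_cst : forall v x, N x -> field_coord (E v) i x = v;
  lf_linl : forall x, N x -> forall w, lin (Gamma x ^~ w);
  lf_linr : forall x, N x -> forall v, lin (Gamma x v);
  lf_Ck : forall k v w, Ck N k (fun x => Gamma x v w);
  lf_nabla : forall X Y x, smooth_field X -> smooth_field Y -> N x ->
    field_coord (nabla X Y) i x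
    = 'D_(field_coord X i x) (field_coord Y i) x
      + Gamma x (field_coord X i x) (field_coord Y i x)
}.

(** The axioms of a connection apply only to global fields, so the expansion of a field in the frame
    has to be made global before they can be used; cutting off both the components and the frame
    achieves this. *)
Lemma local_frame_exists i x0 : chart_image i x0 ->
  exists N E Gamma, N x0 /\ local_frame i N E Gamma.
Proof.
move=> ix0; have [beta [K [cK Ki Cb nb b0]]] := chart_bump HM ix0.
have oi := open_chart_image HM i.
have Cbi k : Ck (chart_image i) k beta by apply: Ck_subset (Cb k).
have supp0 (h : 'rV[R]_n -> 'rV[R]_n) y : chart_image i y -> ~ K y -> beta y *: h y = 0.
  by move=> _ /b0 ->; rewrite scale0r.
have supp0' (h : 'rV[R]_n -> R) y : chart_image i y -> ~ K y -> beta y * h y = 0.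
  by move=> _ /b0 ->; rewrite mul0r.
(* The interior, so that around each point of [N] the bump function is constant and does not
   contribute to derivatives. *)
pose N : set 'rV[R]_n := [set x | beta x = 1]° `&` chart_image i.
pose E v := glue_field i (fun y => beta y *: v) : M -> 'rV[R]_n.
pose Gamma x v w := field_coord (nabla (E v) (E w)) i x.
have sE v : smooth_field (E v).
  apply: (smooth_glue_field HM cK Ki) => [k|y]; last exact: (supp0 (cst v)).
  exact: Ck_scale (Ck_cst _ _ oi).
have cE v y : chart_image i y -> field_coord (E v) i y = beta y *: v.
  by move=> iy; rewrite /E (field_coord_glue HM _ iy).
have lE q : lin (E ^~ q).
  move=> c v w; rewrite /E /glue_field; case: asboolP => [iq|_]; last by rewrite scaler0 addr0.
  have lt := lin_tinv HM (dom_image iq).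
  by rewrite -lt scalerDr !scalerA mulrC.
have Ni x : N x -> chart_image i x by move=> [].
have Gl x : N x -> forall w, lin (Gamma x ^~ w).
  move=> Nx w; apply: (lin_field_coord (Ni x Nx)) => q; exact: lin_nablal.
have Gr x : N x -> forall w, lin (Gamma x w).
  move=> Nx w; apply: (lin_field_coord (Ni x Nx)) => q; exact: lin_nablar.
have Nb x : N x -> beta x = 1 by move=> [/interior_subset].
have nN x : N x -> \near x, beta x = 1 by move=> [].
pose phi := glue_fun i beta : M -> R.
have sphi : smooth_fun phi.
  by apply: (smooth_glue_fun HM cK Ki) => // y _; exact: b0.
pose cmp X j := glue_fun i (fun y => beta y * field_coord X i y 0 j) : M -> R.
have scmp X j : smooth_field X -> smooth_fun (cmp X j).
  move=> /smooth_fieldP sX; apply: (smooth_glue_fun HM cK Ki) => [k|y].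
    exact: Ck_scale (Ck_entry j oi (sX i k)).
  exact: (supp0' (fun y => field_coord X i y 0 j)).
(* The square appears because one factor is spent on the components and the other on the frame; both
   sides are global, and on [N] the left one is [X]. *)
have dec X : (fun q => (phi q * phi q) *: X q) = (fun q => \sum_j cmp X j q *: E (delta_mx 0 j) q).
  apply/funext => q; rewrite /phi /cmp /E /glue_fun /glue_field.
  case: asboolP => [iq|_]; last by rewrite mul0r scale0r big1// => j _; rewrite scale0r.
  have lt := lin_tinv HM (dom_image iq).
  rewrite -{1}(tcoordK HM (X q) iq) -(field_coordE HM _ iq) {1}(row_sum_scale (field_coord X i _)).
  rewrite (lin_sumE lt) scaler_sumr; apply: eq_bigr => j _.
  by rewrite !(linZE lt) !scalerA; congr (_ *: _); rewrite mulrAC.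
have sphi2 := smooth_funM sphi sphi.
exists N, E, Gamma; split; first by split=> //; exact: nb.
split.
- exact: openI (@open_interior _ _) oi.
- exact: Ni.
- exact: sE.
- by move=> v x Nx; rewrite (cE v x (Ni x Nx)) (Nb _ Nx) scale1r.
- exact: Gl.
- exact: Gr.
- move=> k v w; apply: (Ck_subset Ni).
  by have /smooth_fieldP := nabla_smooth (sE v) (sE w); exact.
move=> X Y x sX sY Nx; have ix := Ni x Nx; have [ip ex] := chart_imageP HM ix.
set p := par i x in ip ex *.
have phi1 : phi p = 1 by rewrite /phi /glue_fun asboolT// ex; exact: Nb.
have lin_p := lin_tcoord HM ip.
have nablaXE k : nabla X (E (delta_mx 0 k)) p =
    \sum_j cmp X j p *: nabla (E (delta_mx 0 j)) (E (delta_mx 0 k)) p.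
  rewrite -nabla_suml => [|j|j|]; [|exact: scmp|exact: sE|exact: sE].
  by rewrite -dec (nabla_scalel p sphi2 sX (sE _)) phi1 mul1r scale1r.
have nablaY : nabla X Y p = \sum_k (field_deriv X (cmp Y k) p *: E (delta_mx 0 k) p
    + cmp Y k p *: nabla X (E (delta_mx 0 k)) p).
  rewrite -nabla_sumr => [|j|j|]; [|exact: scmp|exact: sE|exact: sX].
  rewrite -dec; case: Cn => _ _ _ CM; rewrite (CM _ _ _ sphi2 sX sY).
  (* The square of the cutoff is 1 near the point, so the Leibniz term with its derivative vanishes
     and [nabla X Y p] itself remains. *)
  rewrite (@field_deriv_near_cst _ _ 1 i x ix) ?phi1 ?mul1r ?scale0r ?add0r ?scale1r//.
  have nix := open_nbhs_nbhs (conj oi ix).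
  apply: filterS2 (nN _ Nx) nix => y by1 iy.
  have [diy ey] := chart_imageP HM iy.
  by rewrite /phi /glue_fun asboolT// ey by1 mulr1.
have cmpE Z j : cmp Z j p = field_coord Z i x 0 j.
  by rewrite /cmp /glue_fun asboolT// ex (Nb _ Nx) mul1r.
have dcmp k : field_deriv X (cmp Y k) p = 'D_(field_coord X i x) (field_coord Y i) x 0 k.
  have sY' : differentiable (field_coord Y i) x by exact: differentiable_field.
  rewrite (field_derivE HM _ ip); last by rewrite ex; apply: differentiable_smooth_fun => //; exact: scmp.
  rewrite ex -derive_entry//; apply: near_eq_derive.
  have nix := open_nbhs_nbhs (conj oi ix).
  apply: filterS2 (nN _ Nx) nix => y by1 iy.
  have [diy ey] := chart_imageP HM iy.
  by rewrite /= /cmp /glue_fun asboolT// ey by1 mul1r.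
have fcE Z : tcoord i p (Z p) = field_coord Z i x by rewrite -[in RHS]ex (field_coordE HM _ ip).

rewrite -fcE nablaY (lin_sumE lin_p).
rewrite (row_sum_scale ('D_(field_coord X i x) (field_coord Y i) x)).
rewrite (lin_basis (Gr x Nx _) (field_coord Y i x)) -big_split /=; apply: eq_bigr => k _.
rewrite (linDE lin_p) (linZE lin_p) (linZE lin_p).
rewrite (fcE (E (delta_mx 0 k))) (cE _ x ix) (Nb _ Nx) scale1r dcmp cmpE.
congr (_ + _ *: _).
rewrite nablaXE (lin_sumE lin_p) (lin_basis (Gl x Nx _) (field_coord X i x)); apply: eq_bigr => j _.
by rewrite (linZE lin_p) cmpE (fcE (nabla _ _)).
Qed.

End Connections.
Local Opaque derive field_coord tcoord tinv transition field_deriv bracket smooth_field smooth_fun.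

(** The classical argument: the four Bianchi identities obtained by rotating the arguments, with all
    terms normalised by the two skew symmetries, combine linearly to the claim. *)
Lemma pair_symmetry (R : realType) (T : Type) (B : T -> T -> T -> T -> R) :
  (forall a b c d, B a b c d = - B b a c d) -> (forall a b c d, B a b c d = - B a b d c) ->
  (forall a b c d, B a b c d + B b c a d + B c a b d = 0) ->
  forall a b c d, B a b c d = B c d a b.
Proof.
move=> s12 s34 bi a b c d.
have := bi a b c d; have := bi b c d a; have := bi c d a b; have := bi d a b c.
rewrite (s34 a b d c) (s34 b c d a) (s34 c d b a) (s12 d b c a) (s34 b d c a) opprK.
by rewrite (s34 d a c b) (s12 a c d b) (s34 c a d b) opprK; lra.
Qed.

(** The hypothesis equates the two mixed second derivatives of the metric. The [q] are the products
    in which each argument of the metric carries one [Gamma]; they occur on both sides, and what is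
    left is curvature. *)
Lemma skew_algebra (R : realType) (p1 p1' p2 p2' q1 q2 s1 s1' s2 s2' : R) :
  p1 + q1 + s1 + (q2 + p2 + s2) = p1' + q2 + s1' + (q1 + p2' + s2') ->
  (s1 - s1' + p1 - p1') + (s2 - s2' + p2 - p2') = 0.
Proof. by move=> H; lra. Qed.

(** * Metric and curvature in a chart with a local frame *)

Section LocalGeometry.
Context {R : realType} {n : nat} (M : charted R n).
Hypothesis HM : manifold M.
Local Notation crd := (@Defs.coord R n M).
Local Notation par := (@param R n M).
Implicit Types (p q : M) (x y v w : 'rV[R]_n) (X Y Z : M -> 'rV[R]_n).
Variables (g : M -> 'rV[R]_n -> 'rV[R]_n -> R)
  (nabla : (M -> 'rV[R]_n) -> (M -> 'rV[R]_n) -> M -> 'rV[R]_n).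
Hypothesis Hg : riemannian_metric g.
Hypothesis LC : levi_civita g nabla.
Variables (i : Defs.index M) (N : set 'rV[R]_n) (E : 'rV[R]_n -> M -> 'rV[R]_n)
  (Gamma : 'rV[R]_n -> 'rV[R]_n -> 'rV[R]_n -> 'rV[R]_n).
Hypothesis lf : local_frame nabla i N E Gamma.

Let oN : open N := lf_open lf.
Let Ni x : N x -> chart_image i x := @lf_sub _ _ _ _ _ _ _ _ lf x.
Let Cn : connection nabla. Proof. by case: LC. Qed.

Lemma near_frame x : N x -> \forall y \near x, N y.
Proof. by move=> Nx; exact: (open_nbhs_nbhs (conj oN Nx)). Qed.

Lemma derive_frame x v w : N x -> 'D_w (field_coord (E v) i) x = 0.
Proof.
move=> Nx; rewrite -(derive_cst v x w); apply: near_eq_derive.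
by apply: filterS (near_frame Nx) => y; exact: (lf_cst lf).
Qed.

Lemma Gamma_frame x v w : N x -> field_coord (nabla (E v) (E w)) i x = Gamma x v w.
Proof.
move=> Nx; rewrite (lf_nabla lf (lf_smooth lf v) (lf_smooth lf w) Nx).
by rewrite (derive_frame _ _ Nx) add0r !(lf_cst lf _ Nx).
Qed.

Lemma field_coordB X Y x : chart_image i x ->
  field_coord (fun q => X q - Y q) i x = field_coord X i x - field_coord Y i x.
Proof. by move=> [p ip <-]; rewrite !(field_coordE HM _ ip) (linBE (lin_tcoord HM ip)). Qed.

Lemma torsionE X Y : smooth_field X -> smooth_field Y ->
  bracket X Y = fun q => nabla X Y q - nabla Y X q.
Proof. by move=> sX sY; apply/funext => q; case: LC => _ T _; rewrite T. Qed.

Lemma smooth_bracket X Y : smooth_field X -> smooth_field Y -> smooth_field (bracket X Y).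
Proof.
move=> sX sY; rewrite (torsionE sX sY).
exact: (smooth_fieldB HM (nabla_smooth Cn sX sY) (nabla_smooth Cn sY sX)).
Qed.

Lemma field_coord_bracket X Y x : smooth_field X -> smooth_field Y -> chart_image i x ->
  field_coord (bracket X Y) i x = 'D_(field_coord X i x) (field_coord Y i) x
    - 'D_(field_coord Y i x) (field_coord X i) x.
Proof.
by move=> sX sY [p ip <-]; rewrite (field_coordE HM _ ip) (bracketE HM sX sY ip).
Qed.

(** Vanishing torsion applied to two frame fields, whose bracket is zero on [N]. *)
Lemma Gamma_sym x v w : N x -> Gamma x v w = Gamma x w v.
Proof.
move=> Nx; apply/eqP; rewrite -subr_eq0 -!(Gamma_frame _ _ Nx) -(field_coordB _ _ (Ni Nx)).
rewrite -(torsionE (lf_smooth lf v) (lf_smooth lf w)).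
rewrite (field_coord_bracket (lf_smooth lf v) (lf_smooth lf w) (Ni Nx)).
by rewrite !(derive_frame _ _ Nx) subr0.
Qed.

Definition metric_coord x v w : R := g (par i x) (tinv i x v) (tinv i x w).

Lemma riemannian_linl p z : lin (fun v => g p v z).
Proof. by move=> c u v; case: Hg => -> _ _ _. Qed.

Lemma riemannian_sym p v w : g p v w = g p w v.
Proof. by case: Hg => _ + _ _; apply. Qed.

Lemma riemannian_linr p z : lin (g p z).
Proof. by move=> c u v; rewrite !(riemannian_sym p z) (riemannian_linl p z). Qed.

Lemma metric_coord_linl x w : chart_image i x -> lin (metric_coord x ^~ w).
Proof. by move=> ix c u v; rewrite /metric_coord (lin_tinv HM ix) riemannian_linl. Qed.

Lemma metric_coord_linr x v : chart_image i x -> lin (metric_coord x v).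
Proof. by move=> ix c u w; rewrite /metric_coord (lin_tinv HM ix) riemannian_linr. Qed.

Lemma metric_coord_sym x v w : metric_coord x v w = metric_coord x w v.
Proof. exact: riemannian_sym. Qed.

Lemma metric_coord_tcoord p v w : dom i p -> metric_coord (crd i p) (tcoord i p v) (tcoord i p w) = g p v w.
Proof. by move=> ip; rewrite /metric_coord (param_coord HM ip) !(tcoordK HM _ ip). Qed.

Lemma metric_coord_field X Y x : chart_image i x ->
  g (par i x) (X (par i x)) (Y (par i x)) = metric_coord x (field_coord X i x) (field_coord Y i x).
Proof.
by move=> [p ip <-]; rewrite (param_coord HM ip) !(field_coordE HM _ ip) metric_coord_tcoord.
Qed.

Lemma Ck_metric_coord k v w : Ck N k (fun x => metric_coord x v w).
Proof.
case: Hg => _ _ _ /(_ (E v) (E w) (lf_smooth lf v) (lf_smooth lf w)) sg.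
have := Ck_subset (lf_sub lf) ((smooth_onP _ _).1 (sg i) k).
apply: (Ck_eq oN) => x Nx.
by rewrite /= (metric_coord_field _ _ (Ni Nx)) !(lf_cst lf _ Nx).
Qed.

Lemma differentiable_metric_coord v w x : N x -> differentiable (fun y => metric_coord y v w) x.
Proof. exact: CkD (Ck_metric_coord 0 v w). Qed.

Lemma differentiable_Gamma v w x : N x -> differentiable (fun y => Gamma y v w) x.
Proof. exact: CkD (lf_Ck lf 0 v w). Qed.

(** Metric compatibility applied to three frame fields, whose components stay fixed near the
    point. *)
Lemma derive_metric_coord x z v w : N x ->
  'D_z (fun y => metric_coord y v w) x = metric_coord x (Gamma x z v) w + metric_coord x v (Gamma x z w).
Proof.
move=> Nx; have ix := Ni Nx; have [ip ex] := chart_imageP HM ix.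
have [sz sv sw] := And3 (lf_smooth lf z) (lf_smooth lf v) (lf_smooth lf w).
case: LC => _ _ /(_ _ _ _ sz sv sw (par i x)).
have sg : smooth_fun (fun q => g q (E v q) (E w q)) by case: Hg => _ _ _; apply.
rewrite (field_derivE HM _ ip); last by rewrite ex; apply: differentiable_smooth_fun.
rewrite !(metric_coord_field _ _ ix) ex !(lf_cst lf _ Nx) !(Gamma_frame _ _ Nx) => <-.
apply: near_eq_derive; apply: filterS (near_frame Nx) => y Ny.
by rewrite /= (metric_coord_field _ _ (Ni Ny)) !(lf_cst lf _ Ny).
Qed.

Definition curv_coord x a b c := 'D_a (fun y => Gamma y b c) x - 'D_b (fun y => Gamma y a c) x
  + Gamma x a (Gamma x b c) - Gamma x b (Gamma x a c).

Let near_linl x : N x -> \forall y \near x, forall z, lin (Gamma y ^~ z).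
Proof. by move=> Nx; apply: filterS (near_frame Nx) => y; exact: (lf_linl lf). Qed.
Let near_linr x : N x -> \forall y \near x, forall z, lin (Gamma y z).
Proof. by move=> Nx; apply: filterS (near_frame Nx) => y; exact: (lf_linr lf). Qed.

(** [K1], [K2], [K3] stand for the three terms of the curvature applied to Z. The [s] are second
    derivatives of Z, the [d] and [h] belong to the bracket, the [k] pair [Gamma] with a first
    derivative of Z, and the [g] and [l] survive as derivatives and products of [Gamma]. *)
Lemma curvature_algebra (s s' d d1 d2 g1 g2 h h1 h2 k1 k2 l1 l2 K1 K2 K3 : 'rV[R]_n) :
  K1 = s + d1 + (g1 + h1 + k1) + (k2 + l1) -> K2 = s' + d2 + (g2 + h2 + k2) + (k1 + l2) ->
  K3 = d + h -> s = s' -> d = d1 - d2 -> h = h1 - h2 ->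
  K1 - K2 - K3 = g1 - g2 + l1 - l2.
Proof. by move=> -> -> -> -> -> ->; apply/rowP => j; rewrite !mxE; ring. Qed.

(** The right-hand side involves the three fields only through their values at the point. This is
    the tensoriality that makes [curv] independent of the chosen extensions. *)
Lemma field_coord_curvature X Y Z x :
  smooth_field X -> smooth_field Y -> smooth_field Z -> N x ->
  field_coord (curvature nabla X Y Z) i x =
  curv_coord x (field_coord X i x) (field_coord Y i x) (field_coord Z i x).
Proof.
move=> sX sY sZ Nx; have ix := Ni Nx; have sB := smooth_bracket sX sY.
have dZ : differentiable (field_coord Z i) x := differentiable_field sZ ix.
(* Two Leibniz rules at once: for the derivative of Z along the moving vector B, and for [Gamma]
   with both arguments moving. *)
have second A B : smooth_field A -> smooth_field B ->
    field_coord (nabla A (nabla B Z)) i x =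
    'D_(field_coord A i x) ('D_(field_coord B i x) (field_coord Z i)) x
    + 'D_('D_(field_coord A i x) (field_coord B i) x) (field_coord Z i) x
    + ('D_(field_coord A i x) (fun y => Gamma y (field_coord B i x) (field_coord Z i x)) x
       + Gamma x ('D_(field_coord A i x) (field_coord B i) x) (field_coord Z i x)
       + Gamma x (field_coord B i x) ('D_(field_coord A i x) (field_coord Z i) x))
    + (Gamma x (field_coord A i x) ('D_(field_coord B i x) (field_coord Z i) x)
       + Gamma x (field_coord A i x) (Gamma x (field_coord B i x) (field_coord Z i x))).
  move=> sA sB'; have sBZ := nabla_smooth Cn sB' sZ.
  have dB : differentiable (field_coord B i) x := differentiable_field sB' ix.
  rewrite (lf_nabla lf sA sBZ Nx) (lf_nabla lf sB' sZ Nx).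
  rewrite (linDE (lf_linr lf Nx _)); congr (_ + _).
  have lin1 : \forall y \near x, lin (fun v => 'D_v (field_coord Z i) y).
    apply: filterS (near_frame Nx) => y Ny; apply: lin_derive.
    exact: differentiable_field sZ (Ni Ny).
  have dD v : differentiable ('D_v (field_coord Z i)) x.
    by have /smooth_fieldP/(_ i 1%N)[_ /(_ v) [C _]] := sZ; exact: C.
  rewrite -(derive_family lin1 dD _ dB).
  rewrite -(derive_bifamily (near_linl Nx) (near_linr Nx) (fun v w => differentiable_Gamma v w Nx) _ dB dZ).
  rewrite -deriveD; last 2 first.
  - exact/diff_derivable/(differentiable_family lin1 dD dB).
  - apply/diff_derivable.
    exact: (differentiable_bifamily (near_linl Nx) (near_linr Nx) (fun v w => differentiable_Gamma v w Nx)
      dB dZ).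
  apply: near_eq_derive; apply: filterS (near_frame Nx) => y Ny.
  exact: (lf_nabla lf sB' sZ Ny).
have -> : field_coord (curvature nabla X Y Z) i x =
    field_coord (nabla X (nabla Y Z)) i x - field_coord (nabla Y (nabla X Z)) i x
    - field_coord (nabla (bracket X Y) Z) i x.
  by rewrite -!(field_coordB _ _ ix).
have eB := field_coord_bracket sX sY ix.
have /smooth_fieldP/(_ i 1%N) CZ := sZ.
apply: (curvature_algebra (second X Y sX sY) (second Y X sY sX) (lf_nabla lf sB sZ Nx)).
- exact: (derive_comm_rV _ _ (open_chart_image HM i) ix CZ).
- by rewrite eB; exact: deriveBv.
- by rewrite eB; exact: (linBE (lf_linl lf Nx _)).
Qed.

Lemma curv_coord_algebra (s t u v : 'rV[R]_n) : s - t + u - v = - (t - s + v - u).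
Proof. by apply/rowP => j; rewrite !mxE; ring. Qed.

Lemma curv_coord_skew12 x a b c : curv_coord x a b c = - curv_coord x b a c.
Proof. exact: curv_coord_algebra. Qed.

Lemma bianchi_algebra (s1 s2 s3 t1 t2 t3 : 'rV[R]_n) :
  (s1 - s2 + t1 - t2) + (s2 - s3 + t2 - t3) + (s3 - s1 + t3 - t1) = 0.
Proof. by apply/rowP => j; rewrite !mxE; ring. Qed.

(** [Gamma] is symmetric in a neighbourhood, so its derivatives are symmetric too, and the twelve
    terms cancel cyclically. *)
Lemma bianchi x a b c : N x -> curv_coord x a b c + curv_coord x b c a + curv_coord x c a b = 0.
Proof.
move=> Nx; have S u v w : 'D_u (fun y => Gamma y v w) x = 'D_u (fun y => Gamma y w v) x.
  by apply: near_eq_derive; apply: filterS (near_frame Nx) => y Ny; exact: Gamma_sym.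
rewrite /curv_coord (S c b a) (S a c b) (S b a c).
rewrite (Gamma_sym c b Nx) (Gamma_sym a c Nx) (Gamma_sym b a Nx).
exact: bianchi_algebra.
Qed.

(** The second derivatives of the function [metric_coord y c d] commute; expressing both through
    [Gamma] by metric compatibility yields the identity. *)
Lemma curv_coord_skew34 x a b c d : N x ->
  metric_coord x (curv_coord x a b c) d + metric_coord x c (curv_coord x a b d) = 0.
Proof.
move=> Nx; have ix := Ni Nx.
have near_gl : \forall y \near x, forall z, lin (metric_coord y ^~ z).
  by apply: filterS (near_frame Nx) => y Ny z; exact: metric_coord_linl (Ni Ny).
have near_gr : \forall y \near x, forall z, lin (metric_coord y z).
  by apply: filterS (near_frame Nx) => y Ny z; exact: metric_coord_linr (Ni Ny).
have second e f : 'D_e ('D_f (fun y => metric_coord y c d)) x =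
   metric_coord x (Gamma x e (Gamma x f c)) d + metric_coord x (Gamma x f c) (Gamma x e d)
   + metric_coord x ('D_e (fun y => Gamma y f c) x) d
   + (metric_coord x (Gamma x e c) (Gamma x f d) + metric_coord x c (Gamma x e (Gamma x f d))
      + metric_coord x c ('D_e (fun y => Gamma y f d) x)).
  pose F1 y := metric_coord y (Gamma y f c) d; pose F2 y := metric_coord y c (Gamma y f d).
  have -> : 'D_e ('D_f (fun y => metric_coord y c d)) x = 'D_e (fun y => F1 y + F2 y) x.
    apply: near_eq_derive; apply: filterS (near_frame Nx) => y Ny; exact: derive_metric_coord.
  have dG v w : differentiable (fun y => metric_coord y v w) x by exact: differentiable_metric_coord.
  have d1 := differentiable_Gamma f c Nx; have d2 := differentiable_Gamma f d Nx.
  have l1 : \forall y \near x, lin (metric_coord y ^~ d) by apply: filterS near_gl => y; exact.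
  have l2 : \forall y \near x, lin (metric_coord y c) by apply: filterS near_gr => y; exact.
  have D1 : differentiable F1 x := differentiable_family l1 (fun v => dG v d) d1.
  have D2 : differentiable F2 x := differentiable_family l2 (dG c) d2.
  rewrite -(derive_metric_coord e (Gamma x f c) d Nx) -(derive_metric_coord e c (Gamma x f d) Nx).
  apply: etrans (deriveD (diff_derivable D1) (diff_derivable D2)) _.
  congr (_ + _); first exact: (derive_family l1 (fun v => dG v d) e d1).
  exact: (derive_family l2 (dG c) e d2).
have lBD (L : 'rV[R]_n -> R) : lin L -> forall s t u v, L (s - t + u - v) = L s - L t + L u - L v.
  by move=> lL s t u v; rewrite (linBE lL) (linDE lL) (linBE lL).
rewrite /curv_coord (lBD _ (metric_coord_linl d ix)) (lBD _ (metric_coord_linr c ix)).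
apply: skew_algebra.
exact: etrans (esym (second a b)) (etrans (derive_comm b a oN Nx (Ck_metric_coord 1 c d)) (second b a)).
Qed.

Lemma curv_coord_pair x a b c d : N x ->
  metric_coord x (curv_coord x a b c) d = metric_coord x (curv_coord x c d a) b.
Proof.
move=> Nx; have ix := Ni Nx; pose B e f h k := metric_coord x (curv_coord x e f h) k.
have s12 e f h k : B e f h k = - B f e h k.
  by rewrite /B curv_coord_skew12 (linNE (metric_coord_linl _ ix)).
have s34 e f h k : B e f h k = - B e f k h.
  by apply/eqP; rewrite -addr_eq0 /B -(curv_coord_skew34 e f h k Nx) (metric_coord_sym _ h).
have bi e f h k : B e f h k + B f h e k + B h e f k = 0.
  rewrite /B -!(linDE (metric_coord_linl _ ix)) bianchi//; exact: lin0 (metric_coord_linl _ ix).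
exact: pair_symmetry s12 s34 bi _ _ _ _.
Qed.

End LocalGeometry.
Local Opaque derive field_coord tcoord tinv transition field_deriv bracket smooth_field smooth_fun.

(** * The tangent bundle *)

Section RowBlocks.
Context {R : realType}.

Lemma differentiable_row_mx (U : normedModType R) m n (f : U -> 'rV[R]_m) (g : U -> 'rV[R]_n) x :
  differentiable f x -> differentiable g x -> differentiable (fun y => row_mx (f y) (g y)) x.
Proof.
move=> df dg; apply: differentiable_rV => j; case: (split_ordP j) => k ->.
- have -> : (fun y => row_mx (f y) (g y) 0 (lshift n k)) = (fun y => f y 0 k).
    by apply/funext => y; rewrite row_mxEl.
  exact: differentiable_entry.
- have -> : (fun y => row_mx (f y) (g y) 0 (rshift m k)) = (fun y => g y 0 k).
    by apply/funext => y; rewrite row_mxEr.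
  exact: differentiable_entry.
Qed.

Lemma derive_row_mx (U : normedModType R) m n (f : U -> 'rV[R]_m) (g : U -> 'rV[R]_n) x v :
  differentiable f x -> differentiable g x ->
  'D_v (fun y => row_mx (f y) (g y)) x = row_mx ('D_v f x) ('D_v g x).
Proof.
move=> df dg; apply/rowP => j; rewrite -(derive_entry _ _ (differentiable_row_mx df dg)).
case: (split_ordP j) => k ->.
- have -> : (fun y => row_mx (f y) (g y) 0 (lshift n k)) = (fun y => f y 0 k).
    by apply/funext => y; rewrite row_mxEl.
  exact: etrans (derive_entry v k df) (esym (row_mxEl _ _ _ _)).
- have -> : (fun y => row_mx (f y) (g y) 0 (rshift m k)) = (fun y => g y 0 k).
    by apply/funext => y; rewrite row_mxEr.
  exact: etrans (derive_entry v k dg) (esym (row_mxEr _ _ _ _)).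
Qed.

Lemma Ck_row_mx p m n k (U : set 'rV[R]_p) (f : 'rV[R]_p -> 'rV[R]_m) (g : 'rV[R]_p -> 'rV[R]_n) :
  open U -> Ck U k f -> Ck U k g -> Ck U k (fun y => row_mx (f y) (g y)).
Proof.
move=> oU Cf Cg; apply: Ck_rV => // j; case: (split_ordP j) => i ->.
- by apply: (Ck_eq oU _ (Ck_entry i oU Cf)) => y _; rewrite row_mxEl.
- by apply: (Ck_eq oU _ (Ck_entry i oU Cg)) => y _; rewrite row_mxEr.
Qed.

Variables (m n : nat).
Implicit Types (w : 'rV[R]_(m + n)).

Lemma Ck_lsubmx k (U : set 'rV[R]_(m + n)) : open U -> Ck U k (@lsubmx R 1 m n).
Proof. move=> oU; apply: (Ck_linear k (L := @lsubmx R 1 m n)) => //; exact: continuous_lsubmx. Qed.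

Lemma Ck_rsubmx k (U : set 'rV[R]_(m + n)) : open U -> Ck U k (@rsubmx R 1 m n).
Proof. move=> oU; apply: (Ck_linear k (L := @rsubmx R 1 m n)) => //; exact: continuous_rsubmx. Qed.

Lemma derive_rsubmx w v : 'D_v (@rsubmx R 1 m n) w = rsubmx v.
Proof.
rewrite deriveE; last exact: differentiable_rsubmx.
by rewrite (@diff_lin _ _ _ (@rsubmx R 1 m n))//; exact: continuous_rsubmx.
Qed.

Lemma open_lsubmx (U : set 'rV[R]_m) : open U -> open [set w : 'rV[R]_(m + n) | U (lsubmx w)].
Proof.
move=> oU; apply: (@open_comp _ _ (@lsubmx R 1 m n)) => // w _.
exact: continuous_lsubmx.
Qed.

Lemma Ck_comp_lsubmx (V : normedModType R) k (U : set 'rV[R]_m) (f : 'rV[R]_m -> V) :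
  open U -> Ck U k f -> Ck [set w : 'rV[R]_(m + n) | U (lsubmx w)] k (fun w : 'rV[R]_(m + n) => f (lsubmx w)).
Proof.
move=> oU Cf; have o := open_lsubmx oU.
exact: (Ck_comp o (Ck_lsubmx k o) Cf).
Qed.

(** Holds for every [f], since the two difference quotients coincide: [lsubmx] is linear. Hence
    [derive] is made transparent here. *)
Lemma derive_comp_lsubmx (V : normedModType R) (f : 'rV[R]_m -> V) w v :
  'D_v (fun w : 'rV[R]_(m + n) => f (lsubmx w)) w = 'D_(lsubmx v) f (lsubmx w).
Proof.
Local Transparent derive.
rewrite /derive; set F := (fun h : R => _); set G := (fun h : R => _).
suff -> : F = G by [].
apply/funext => h; rewrite /F /G /=; congr (_ *: (f _ - _)).
exact: (linearP (@lsubmx R 1 m n) h v w).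
Qed.
Local Opaque derive.

End RowBlocks.

Section TangentCharts.
Context {R : realType} {n : nat} (M : charted R n).
Hypothesis HM : manifold M.
Local Notation TM := (tangent_bundle M).
Local Notation crd := (@Defs.coord R n M).
Local Notation par := (@param R n M).
Local Notation crdT := (@Defs.coord R (n + n) TM).
Local Notation parT := (@param R (n + n) TM).
Implicit Types (i j : Defs.index M) (p q : M) (x y v : 'rV[R]_n) (w : 'rV[R]_(n + n)).
Implicit Types (z : TM).

Lemma tinv_imageK i x v : chart_image i x -> tcoord i (par i x) (tinv i x v) = v.
Proof. by move=> [p ip <-]; rewrite (param_coord HM ip) (tinvK HM v ip). Qed.

Lemma crdTE i z : crdT i z = row_mx (crd i z.1) (tcoord i z.1 z.2).
Proof. by []. Qed.

Lemma parTE i w : parT i w = (par i (lsubmx w), tinv i (lsubmx w) (rsubmx w)).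
Proof. by []. Qed.

Lemma parT_coord i z : dom i z.1 -> parT i (crdT i z) = z.
Proof.
case: z => p u ip; rewrite parTE crdTE row_mxKl row_mxKr.
by rewrite (param_coord HM ip) (tcoordK HM u ip).
Qed.

Lemma chart_imageT i w : @chart_image _ _ TM i w -> chart_image i (lsubmx w).
Proof. by move=> [z iz <-]; rewrite crdTE row_mxKl; exact: dom_image. Qed.

Lemma crdT_par i w : chart_image i (lsubmx w) -> crdT i (parT i w) = w.
Proof.
move=> iw; rewrite crdTE parTE /=; have [ip ex] := chart_imageP HM iw.
by rewrite ex (tinv_imageK _ iw) hsubmxK.
Qed.

Lemma transitionT i j w : overlap i j (lsubmx w) ->
  @transition _ _ TM i j w =
  row_mx (transition i j (lsubmx w)) ('D_(rsubmx w) (transition i j) (lsubmx w)).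
Proof.
move=> ijw; rewrite -[LHS]/(crdT j (parT i w)) crdTE parTE /=; congr row_mx.
case: ijw => p [ip jp] <-; rewrite (param_coord HM ip).
by rewrite (tcoord_change HM _ ip jp) (tinvK HM _ ip).
Qed.

Lemma open_overlapT i j : open [set w : 'rV[R]_(n + n) | overlap i j (lsubmx w)].
Proof. exact: open_lsubmx (open_overlap HM i j). Qed.

Lemma Ck_transitionT i j k : Ck [set w : 'rV[R]_(n + n) | overlap i j (lsubmx w)] k
  (@transition _ _ TM i j).
Proof.
have oij := open_overlap HM i j; have o := @open_overlapT i j.
have Ct := Ck_comp_lsubmx n oij (Ck_transition HM i j k).
have CD v : Ck [set w : 'rV[R]_(n + n) | overlap i j (lsubmx w)] k
    (fun w : 'rV[R]_(n + n) => 'D_v (transition i j) (lsubmx w)).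
  have [_ /(_ v) C] := Ck_transition HM i j k.+1; exact: Ck_comp_lsubmx oij C.
have lD w : overlap i j (lsubmx w) -> lin (fun v => 'D_v (transition i j) (lsubmx w)).
  by move=> ijw; apply: lin_derive; exact: differentiable_transition.
apply: (Ck_eq o _ (Ck_row_mx o Ct (Ck_family o lD CD (Ck_rsubmx k o)))) => w ijw.
by rewrite transitionT.
Qed.

Lemma differentiable_transitionT i j z : dom i z.1 -> dom j z.1 ->
  differentiable (@transition _ _ TM i j) (crdT i z).
Proof.
move=> iz jz; apply: (CkD (Ck_transitionT i j 0)).
by rewrite /= row_mxKl; exact: dom_overlap.
Qed.

Lemma tcoordTE i z w : @tcoord _ _ TM i z w =
  'D_w (@transition _ _ TM (pref z.1) i) (crdT (pref z.1) z).
Proof. exact: tcoordE. Qed.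

Lemma lin_tcoordT i z : dom i z.1 -> lin (@tcoord _ _ TM i z).
Proof.
move=> iz c u v; rewrite !tcoordTE; apply: lin_derive.
by apply: differentiable_transitionT => //; exact: pref_dom.
Qed.

Lemma tcoordT_pref z w : @tcoord _ _ TM (pref z.1) z w = w.
Proof.
rewrite tcoordTE; set j := pref z.1; rewrite -[RHS](derive_id (crdT j z)).
have jz : chart_image j (crd j z.1) by exact: dom_image (pref_dom HM _).
apply: near_eq_derive.
have jw : [set w : 'rV[R]_(n + n) | chart_image j (lsubmx w)] (crdT j z) by rewrite /= row_mxKl.
apply: filterS (open_nbhs_nbhs (conj (@open_lsubmx R n n _ (open_chart_image HM j)) jw)) => y jy.
exact: crdT_par.
Qed.

(** In every chart the curve defining the lift is affine in [s], with constant base part and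
    velocity [tcoord] of [v] in the fibre; the chain rule compares the preferred chart with chart
    [i]. *)
Lemma tcoordT_vlift i z v : dom i z.1 ->
  @tcoord _ _ TM i z (vlift_at z v) = row_mx 0 (tcoord i z.1 v).
Proof.
case: z => p u ip; rewrite tcoordTE; set j := pref p.
rewrite -[LHS]/('D_('D_1 (fun s : R => crdT j ((p, u + s *: v) : TM)) 0)
  (@transition _ _ TM j i) (crdT j ((p, u) : TM))) -[tcoord i _ v]/(tcoord i p v).
have jp : dom j p := pref_dom HM p.
have lj := lin_tcoord HM jp; have li := lin_tcoord HM ip.
have dc k : dom k p -> differentiable (fun s : R => crdT k ((p, u + s *: v) : TM)) (0 : R) /\
    'D_1 (fun s : R => crdT k ((p, u + s *: v) : TM)) (0 : R) = row_mx 0 (tcoord k p v).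
  move=> kp; have lk := lin_tcoord HM kp.
  have -> : (fun s : R => crdT k ((p, u + s *: v) : TM)) =
            (fun s : R => row_mx (crd k p) (s *: tcoord k p v + tcoord k p u)).
    by apply/funext => s; rewrite crdTE /= addrC lk.
  have d1 : differentiable (fun s : R => s *: tcoord k p v) (0 : R) by [].
  have d2 : differentiable (fun=> tcoord k p u) (0 : R) by exact: differentiable_cst.
  have d3 : differentiable (fun=> crd k p) (0 : R) by exact: differentiable_cst.
  split; first exact: (differentiable_row_mx d3 (differentiableD d1 d2)).
  rewrite (derive_row_mx _ d3 (differentiableD d1 d2)) derive_cst; congr row_mx.
  rewrite (deriveD (diff_derivable d1) (diff_derivable d2)) derive_cst addr0.
  by rewrite deriveE// diff_val scale1r.
have [djc Dj] := dc j jp; have [dic Di] := dc i ip.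
have fE : (fun s : R => crdT i ((p, u + s *: v) : TM))
    = (fun s => @transition _ _ TM j i (crdT j ((p, u + s *: v) : TM))).
  apply/funext => s; exact: (congr1 (crdT i) (esym (@parT_coord j (p, u + s *: v) jp))).
have u0 : u + (0 : R) *: v = u by rewrite scale0r addr0.
have dT : differentiable (@transition _ _ TM j i) (crdT j ((p, u + (0 : R) *: v) : TM)).
  by rewrite u0; exact: (@differentiable_transitionT j i (p, u) jp ip).
have D2 := @derive_comp R R _ _ _ _ 0 1 djc dT; rewrite u0 -fE in D2.
exact: etrans (esym D2) Di.
Qed.

Lemma tcoordT_section i p (U : M -> 'rV[R]_n) v : smooth_field U -> dom i p ->
  @tcoord _ _ TM i (p, U p) (tangent_map (fun q : M => (q, U q) : TM) p v)
  = row_mx (tcoord i p v) ('D_(tcoord i p v) (field_coord U i) (crd i p)).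
Proof.
move=> sU ip; rewrite tcoordTE; set j := pref p.
have jp : dom j p := pref_dom HM p.
have o := dom_overlap jp ip; have jx := dom_image jp; have ix := dom_image ip.
pose c y := crdT j ((par j y, U (par j y)) : TM).
have dU := differentiable_field sU jx; have dUi := differentiable_field sU ix.
have dc : differentiable c (crd j p).
  apply: (@near_eq_differentiable _ _ _ (fun y => row_mx y (field_coord U j y))).
    apply: filterS (open_nbhs_nbhs (conj (open_chart_image HM j) jx)) => y [q jq <-].
    by rewrite /c crdTE /= (param_coord HM jq) (field_coordE HM _ jq).
  by apply: differentiable_row_mx.
have cx : c (crd j p) = crdT j ((p, U p) : TM) by rewrite /c (param_coord HM jp).
have dt : differentiable (transition j i) (crd j p) by exact: differentiable_transition.
have dT : differentiable (@transition _ _ TM j i) (c (crd j p)).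
  by rewrite cx; exact: (@differentiable_transitionT j i (p, U p) jp ip).
have D2 := derive_comp v dc dT; rewrite cx in D2.
apply: etrans (esym D2) _.
have tE : transition j i (crd j p) = crd i p by rewrite (transition_coord HM _ jp).
have dUt : differentiable (field_coord U i) (transition j i (crd j p)) by rewrite tE.
have dUc : differentiable (fun y => field_coord U i (transition j i y)) (crd j p).
  exact: (differentiable_comp dt dUt).
have E2 := derive_comp v dt dUt; rewrite tE in E2.
rewrite (tcoordE i p v) -E2 -(derive_row_mx v dt dUc); apply: near_eq_derive.
apply: filterS (near_overlap HM o) => y [q [jq iq] <-].
have eq1 := @parT_coord j (q, U q) jq.
rewrite (transition_coord HM _ jq) (field_coordE HM _ iq) /c (param_coord HM jq).
exact: (congr1 (crdT i) eq1).
Qed.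

Variable nabla : (M -> 'rV[R]_n) -> (M -> 'rV[R]_n) -> M -> 'rV[R]_n.
Hypothesis Cn : connection nabla.

(** The derivative of the chosen extension of [u] occurs both in the differential of the section and
    in the covariant derivative subtracted from it; it cancels, leaving only [Gamma]. *)
Lemma tcoordT_hlift i N E Gamma p u v : local_frame nabla i N E Gamma -> N (crd i p) -> dom i p ->
  @tcoord _ _ TM i (p, u) (hlift_at nabla ((p, u) : TM) v)
  = row_mx (tcoord i p v) (- Gamma (crd i p) (tcoord i p v) (tcoord i p u)).
Proof.
move=> lf Np ip.
have [sU eU] := extendP HM p u; have [sV eV] := extendP HM p v.
have t1 := tcoordT_section v sU ip; rewrite eU in t1.
have t2 : @tcoord _ _ TM i (p, u)
    (vlift_at ((p, u) : TM) (nabla (extend p v) (extend p u) p))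
    = row_mx 0 (tcoord i p (nabla (extend p v) (extend p u) p)).
  exact: (@tcoordT_vlift i (p, u) _ ip).
apply: etrans (linBE (@lin_tcoordT i (p, u) ip) _ _) _.
apply: etrans (congr2 (fun a b => a - b) t1 t2) _.
have nE : tcoord i p (nabla (extend p v) (extend p u) p) =
    'D_(tcoord i p v) (field_coord (extend p u) i) (crd i p)
    + Gamma (crd i p) (tcoord i p v) (tcoord i p u).
  apply: etrans (esym (field_coordE HM _ ip)) _.
  have := lf_nabla lf sV sU Np.
  by rewrite (field_coordE HM (extend p v) ip) (field_coordE HM (extend p u) ip) eU eV.
by rewrite nE opp_row_mx add_row_mx oppr0 addr0 opprD addrA subrr add0r.
Qed.

Lemma field_coordT_vlift X i w : chart_image i (lsubmx w) ->
  @field_coord _ _ TM (vlift X) i w = row_mx 0 (field_coord X i (lsubmx w)).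
Proof.
move=> iw; have [ip _] := chart_imageP HM iw.
exact: (@tcoordT_vlift i (parT i w) _ ip).
Qed.

Lemma field_coordT_hlift i N E Gamma X w : local_frame nabla i N E Gamma -> N (lsubmx w) ->
  @field_coord _ _ TM (hlift nabla X) i w
  = row_mx (field_coord X i (lsubmx w))
      (- Gamma (lsubmx w) (field_coord X i (lsubmx w)) (rsubmx w)).
Proof.
move=> lf Nw; have iw := lf_sub lf Nw; have [ip ex] := chart_imageP HM iw.
have Np : N (crd i (par i (lsubmx w))) by rewrite ex.
have := @tcoordT_hlift i N E Gamma (par i (lsubmx w)) (tinv i (lsubmx w) (rsubmx w))
  (X (par i (lsubmx w))) lf Np ip.
by rewrite ex (tinv_imageK _ iw).
Qed.

Lemma smooth_vlift X : smooth_field X -> @smooth_field _ _ TM (vlift X).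
Proof.
move=> /smooth_fieldP sX; apply/smooth_fieldP => i k.
have oi := open_chart_image HM i; have o := @open_lsubmx R n n _ oi.
apply: (Ck_subset (@chart_imageT i)).
have C := Ck_row_mx o (Ck_cst k (0 : 'rV[R]_n) o) (Ck_comp_lsubmx n oi (sX i k)).
by apply: (Ck_eq o _ C) => w iw; rewrite (field_coordT_vlift X iw).
Qed.

Lemma smooth_hlift X : smooth_field X -> @smooth_field _ _ TM (hlift nabla X).
Proof.
move=> /smooth_fieldP sX; apply/smooth_fieldP => i k; apply: Ck_local => w /chart_imageT iw.
have [N [E [Gamma [Nw lf]]]] := local_frame_exists HM Cn iw.
have oN := lf_open lf; have o := @open_lsubmx R n n _ oN.
exists [set w : 'rV[R]_(n + n) | N (lsubmx w)]; first exact: open_nbhs_nbhs (conj o Nw).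
have CX := Ck_comp_lsubmx n oN (Ck_subset (lf_sub lf) (sX i k)).
have CG := Ck_bifamily o (fun w Nw => lf_linl lf Nw) (fun w Nw => lf_linr lf Nw)
  (fun u v => Ck_comp_lsubmx n oN (lf_Ck lf k u v)) CX (Ck_rsubmx k o).
have C := Ck_row_mx o CX (Ck_scale o (Ck_cst k (-1 : R) o) CG).
apply: (Ck_eq o _ C) => y Ny; rewrite (field_coordT_hlift X lf Ny).
by rewrite scaleN1r.
Qed.

End TangentCharts.
Local Opaque derive field_coord tcoord tinv transition field_deriv bracket smooth_field smooth_fun.

(** * Brackets of lifts at a point of the tangent bundle *)

Section LiftBrackets.
Context {R : realType} {n : nat} (M : charted R n).
Hypothesis HM : manifold M.
Local Notation TM := (tangent_bundle M).
Local Notation crd := (@Defs.coord R n M).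
Local Notation par := (@param R n M).
Local Notation crdT := (@Defs.coord R (n + n) TM).
Local Notation parT := (@param R (n + n) TM).
Variables (g : M -> 'rV[R]_n -> 'rV[R]_n -> R)
  (nabla : (M -> 'rV[R]_n) -> (M -> 'rV[R]_n) -> M -> 'rV[R]_n).
Hypothesis Hg : riemannian_metric g.
Hypothesis LC : levi_civita g nabla.
Let Cn : connection nabla. Proof. by case: LC. Qed.
Variables (p : M) (u : 'rV[R]_n).
Local Notation j := (pref p).
Local Notation x0 := (crd j p).
Local Notation z := ((p, u) : TM).
Variables (N : set 'rV[R]_n) (E : 'rV[R]_n -> M -> 'rV[R]_n)
  (Gamma : 'rV[R]_n -> 'rV[R]_n -> 'rV[R]_n -> 'rV[R]_n).
Hypothesis lf : local_frame nabla j N E Gamma.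
Hypothesis Nx0 : N x0.
Implicit Types (X Y Z : M -> 'rV[R]_n) (v xi eta : 'rV[R]_n).

Let jp : dom j p := pref_dom HM p.
Let jx0 : chart_image j x0 := dom_image jp.
Let oNT := @open_lsubmx R n n _ (lf_open lf).

(** All work at [z] is done in its preferred chart, where [tcoord] is the identity and the value of
    a field at [z] is its row of components. *)
Lemma crdT_base : crdT j z = row_mx x0 u.
Proof. by rewrite crdTE tcoord_pref. Qed.

Lemma lsub_base : lsubmx (crdT j z) = x0. Proof. by rewrite crdT_base row_mxKl. Qed.
Lemma rsub_base : rsubmx (crdT j z) = u. Proof. by rewrite crdT_base row_mxKr. Qed.

Lemma near_baseT : \forall w \near crdT j z, N (lsubmx w).
Proof.
have Nw : [set w : 'rV[R]_(n + n) | N (lsubmx w)] (crdT j z) by rewrite /mkset lsub_base.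
exact: open_nbhs_nbhs (conj oNT Nw).
Qed.

Lemma vliftE v : vlift_at z v = row_mx 0 v.
Proof.
rewrite -(tcoordT_pref HM z (vlift_at z v)) -[in RHS](tcoord_pref HM p v).
exact: (@tcoordT_vlift R n M HM j z v jp).
Qed.

Lemma hliftE v : hlift_at nabla z v = row_mx v (- Gamma x0 v u).
Proof.
rewrite -(tcoordT_pref HM z (hlift_at nabla z v)).
apply: etrans (tcoordT_hlift HM u v lf Nx0 jp) _.
by rewrite !(tcoord_pref HM p).
Qed.

Lemma differentiable_lsub_field X : smooth_field X ->
  differentiable (fun w : 'rV[R]_(n + n) => field_coord X j (lsubmx w)) (crdT j z).
Proof.
move=> sX; apply: differentiable_comp; first exact: differentiable_lsubmx.
by rewrite lsub_base; exact: differentiable_field.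
Qed.

Let DX X w : 'D_w (fun w : 'rV[R]_(n + n) => field_coord X j (lsubmx w)) (crdT j z)
  = 'D_(lsubmx w) (field_coord X j) x0.
Proof. by rewrite derive_comp_lsubmx lsub_base. Qed.

Lemma derive_lsub_field X xi eta :
  'D_(row_mx xi eta) (fun w : 'rV[R]_(n + n) => field_coord X j (lsubmx w)) (crdT j z)
  = 'D_xi (field_coord X j) x0.
Proof. by rewrite DX row_mxKl. Qed.

Lemma differentiable_rsub_base : differentiable (@rsubmx R 1 n n) (crdT j z).
Proof. exact: differentiable_rsubmx. Qed.

Lemma field_coord_base X : field_coord X j (lsubmx (crdT j z)) = X p.
Proof. by rewrite lsub_base (field_coord_pref HM). Qed.

Lemma derive_vlift X xi eta : smooth_field X ->
  'D_(row_mx xi eta) (@field_coord _ _ TM (vlift X) j) (crdT j z)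
  = row_mx 0 ('D_xi (field_coord X j) x0).
Proof.
move=> sX.
have e : 'D_(row_mx xi eta) (@field_coord _ _ TM (vlift X) j) (crdT j z) =
  'D_(row_mx xi eta) (fun w : 'rV[R]_(n + n) => row_mx (0 : 'rV[R]_n) (field_coord X j (lsubmx w))) (crdT j z).
  apply: near_eq_derive; apply: filterS near_baseT => w Nw.
  exact: (field_coordT_vlift HM X (lf_sub lf Nw)).
have dc : differentiable (fun _ : 'rV[R]_(n + n) => 0 : 'rV[R]_n) (crdT j z) by exact: differentiable_cst.
apply: etrans e _; apply: etrans (derive_row_mx _ dc (differentiable_lsub_field sX)) _.
exact: (congr2 (@row_mx R 1 n n) (derive_cst _ _ _) (derive_lsub_field X xi eta)).
Qed.

Let Bl : \forall w \near crdT j z, forall v, lin (Gamma (lsubmx w) ^~ v).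
Proof. by apply: filterS near_baseT => w Nw; exact: (lf_linl lf). Qed.
Let Br : \forall w \near crdT j z, forall v, lin (Gamma (lsubmx w) v).
Proof. by apply: filterS near_baseT => w Nw; exact: (lf_linr lf). Qed.
Let dB v v' : differentiable (fun w : 'rV[R]_(n + n) => Gamma (lsubmx w) v v') (crdT j z).
Proof.
apply: (@differentiable_comp _ _ _ _ (@lsubmx R 1 n n) (fun y => Gamma y v v')).
  exact: differentiable_lsubmx.
by rewrite lsub_base; exact: (CkD (lf_Ck lf 0 v v')).
Qed.

Lemma derive_hlift X xi eta : smooth_field X ->
  'D_(row_mx xi eta) (@field_coord _ _ TM (hlift nabla X) j) (crdT j z)
  = row_mx ('D_xi (field_coord X j) x0)
     (- ('D_xi (fun y => Gamma y (X p) u) x0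
         + Gamma x0 ('D_xi (field_coord X j) x0) u + Gamma x0 (X p) eta)).
Proof.
move=> sX.
pose F (w : 'rV[R]_(n + n)) := Gamma (lsubmx w) (field_coord X j (lsubmx w)) (rsubmx w).
have e : 'D_(row_mx xi eta) (@field_coord _ _ TM (hlift nabla X) j) (crdT j z) =
  'D_(row_mx xi eta) (fun w : 'rV[R]_(n + n) => row_mx (field_coord X j (lsubmx w)) (- F w)) (crdT j z).
  apply: near_eq_derive; apply: filterS near_baseT => w Nw.
  exact: (field_coordT_hlift HM X lf Nw).
have dF : differentiable F (crdT j z) := differentiable_bifamily Bl Br dB
  (differentiable_lsub_field sX) differentiable_rsub_base.
have dNF : differentiable (fun w => - F w) (crdT j z) by exact: differentiableN.
apply: etrans e _; apply: etrans (derive_row_mx _ (differentiable_lsub_field sX) dNF) _.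
apply: (congr2 (@row_mx R 1 n n) (derive_lsub_field X xi eta)).
apply: etrans (deriveN (diff_derivable dF)) _; apply: (congr1 -%R).
apply: etrans (derive_bifamily Bl Br dB _ (differentiable_lsub_field sX) differentiable_rsub_base) _.
rewrite field_coord_base rsub_base derive_lsub_field derive_rsubmx row_mxKr lsub_base.
apply: (congr1 (fun v => v + _ + _)).
apply: etrans (derive_comp_lsubmx (fun y => Gamma y (X p) u) _ _) _.
by rewrite lsub_base row_mxKl.
Qed.

Local Transparent bracket.
Lemma bracketTE (A B : TM -> 'rV[R]_(n + n)) : bracket A B z =
  'D_(A z) (field_coord B j) (crdT j z) - 'D_(B z) (field_coord A j) (crdT j z).
Proof. exact: erefl. Qed.
Local Opaque bracket.

Let DV X w xi eta : smooth_field X -> w = row_mx xi eta ->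
  'D_w (@field_coord _ _ TM (vlift X) j) (crdT j z) = row_mx 0 ('D_xi (field_coord X j) x0).
Proof. by move=> sX ->; exact: derive_vlift. Qed.

Let DH X w xi eta : smooth_field X -> w = row_mx xi eta ->
  'D_w (@field_coord _ _ TM (hlift nabla X) j) (crdT j z) = row_mx ('D_xi (field_coord X j) x0)
     (- ('D_xi (fun y => Gamma y (X p) u) x0
         + Gamma x0 ('D_xi (field_coord X j) x0) u + Gamma x0 (X p) eta)).
Proof. by move=> sX ->; exact: derive_hlift. Qed.

Let vX X : vlift X z = row_mx 0 (X p) := vliftE (X p).
Let hX X : hlift nabla X z = row_mx (X p) (- Gamma x0 (X p) u) := hliftE (X p).

Let sub_row_mx (a b c d : 'rV[R]_n) : row_mx a b - row_mx c d = row_mx (a - c) (b - d).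
Proof. by rewrite opp_row_mx add_row_mx. Qed.

Let D0 X : 'D_0 (field_coord X j) x0 = 0. Proof. exact: derive0. Qed.

Lemma bracket_vv X Y : smooth_field X -> smooth_field Y ->
  @bracket _ _ TM (vlift X) (vlift Y) z = 0.
Proof.
move=> sX sY; apply: etrans (bracketTE _ _) _.
apply: etrans (congr2 (fun a b => a - b) (DV sY (vX X)) (DV sX (vX Y))) _.
by rewrite D0 D0 subrr.
Qed.

Lemma nabla_base X Y : smooth_field X -> smooth_field Y ->
  nabla X Y p = 'D_(X p) (field_coord Y j) x0 + Gamma x0 (X p) (Y p).
Proof.
move=> sX sY; apply: etrans (esym (field_coord_pref HM (nabla X Y) p)) _.
apply: etrans (lf_nabla lf sX sY Nx0) _.
by rewrite (field_coord_pref HM X) (field_coord_pref HM Y).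
Qed.

Let hv_algebra (d g0 h k : 'rV[R]_n) : g0 = 0 -> h = 0 -> d - - (g0 + h + k) = d + k.
Proof. by move=> -> ->; rewrite !add0r opprK. Qed.

(** Along a vertical direction the components of X^H change only through their linear dependence on
    the fibre variable; this supplies the [Gamma] term that completes D_X Y to the covariant
    derivative. *)
Lemma bracket_hv X Y : smooth_field X -> smooth_field Y ->
  @bracket _ _ TM (hlift nabla X) (vlift Y) z = vlift_at z (nabla X Y p).
Proof.
move=> sX sY; apply: etrans (bracketTE _ _) _.
apply: etrans (congr2 (fun a b => a - b) (DV sY (hX X)) (DH sX (vX Y))) _.
rewrite sub_row_mx D0 subrr vliftE (nabla_base sX sY); apply: congr1.
by apply: hv_algebra; [exact: derive0|exact: lin0 (lf_linl lf Nx0 u)].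
Qed.

Let hh_algebra (d1 d2 g1 g2 s1 s2 t1 t2 : 'rV[R]_n) :
  - (g1 + s1 + - t1) - - (g2 + s2 + - t2) = - (s1 - s2) - (g1 - g2 + t2 - t1).
Proof. by apply/rowP => k; rewrite !mxE; ring. Qed.

Lemma curv_base v v' : curv nabla p v v' u = curv_coord Gamma x0 v v' u.
Proof.
have [sv ev] := extendP HM p v; have [sv' ev'] := extendP HM p v'.
have [su eu] := extendP HM p u.
apply: etrans (esym (field_coord_pref HM (curvature nabla (extend p v) (extend p v') (extend p u)) p)) _.
apply: etrans (field_coord_curvature HM LC lf sv sv' su Nx0) _.
by rewrite (field_coord_pref HM (extend p v)) (field_coord_pref HM (extend p v'))
  (field_coord_pref HM (extend p u)) ev ev' eu.
Qed.

Lemma bracket_base X Y : smooth_field X -> smooth_field Y ->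
  bracket X Y p = 'D_(X p) (field_coord Y j) x0 - 'D_(Y p) (field_coord X j) x0.
Proof.
move=> sX sY; apply: etrans (esym (field_coord_pref HM (bracket X Y) p)) _.
apply: etrans (field_coord_bracket HM sX sY jx0) _.
by rewrite (field_coord_pref HM X) (field_coord_pref HM Y).
Qed.

(** In the fibre component, the terms where a field is differentiated form - Gamma([X, Y], u), as a
    horizontal lift requires; the derivatives and products of [Gamma] form the curvature. *)
Lemma bracket_hh X Y : smooth_field X -> smooth_field Y ->
  @bracket _ _ TM (hlift nabla X) (hlift nabla Y) z
  = hlift_at nabla z (bracket X Y p) - vlift_at z (curv nabla p (X p) (Y p) u).
Proof.
move=> sX sY; apply: etrans (bracketTE _ _) _.
apply: etrans (congr2 (fun a b => a - b) (DH sY (hX X)) (DH sX (hX Y))) _.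
rewrite hliftE vliftE sub_row_mx sub_row_mx subr0 (bracket_base sX sY); apply: congr1.
rewrite curv_base (linBE (lf_linl lf Nx0 u)).
rewrite (linNE (lf_linr lf Nx0 (Y p))) (linNE (lf_linr lf Nx0 (X p))).
exact: hh_algebra.
Qed.

End LiftBrackets.
Local Opaque derive field_coord tcoord tinv transition bracket smooth_field smooth_fun.

Lemma koszul_algebra (R : realType) (gABC gBAC gACB gCAB gBCA gCBA dA dB dC k1 k2 k3 : R) :
  dA = gABC + gACB -> dB = gBAC + gBCA -> dC = gCAB + gCBA ->
  k1 = gABC - gBAC -> k2 = gACB - gCAB -> k3 = gBCA - gCBA ->
  2 * gABC = dA + dB - dC + k1 - k2 - k3.
Proof. by move=> -> -> -> -> -> ->; ring. Qed.

Lemma product_rule_algebra (R : realType) (at' bt gcu ha hb r r' q1 q1' q2 q2' : R) :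
  at' *: r' + r *: (ha * gcu) + (bt * q1 *: q2' + q2 *: (bt *: q1' + q1 *: (hb * gcu)))
  = ha * gcu * r + at' * r' + hb * gcu * q1 * q2 + bt * q1' * q2 + bt * q1 * q2'.
Proof. by rewrite -![_ *: _]/(_ * _); ring. Qed.

(** Stated for any charted space because it serves twice: for [gA], and for [g] to recognise the
    horizontal part of the derivative of Y^H along X^H. *)
Lemma koszul (R : realType) n (M : charted R n) (g : M -> 'rV[R]_n -> 'rV[R]_n -> R) nabla
    (A B C : M -> 'rV[R]_n) p :
  riemannian_metric g -> levi_civita g nabla ->
  smooth_field A -> smooth_field B -> smooth_field C ->
  2 * g p (nabla A B p) (C p) =
    field_deriv A (fun q => g q (B q) (C q)) p + field_deriv B (fun q => g q (A q) (C q)) p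
    - field_deriv C (fun q => g q (A q) (B q)) p
    + g p (bracket A B p) (C p) - g p (bracket A C p) (B p) - g p (bracket B C p) (A p).
Proof.
move=> Hg [_ tor compat] sA sB sC.
have sym v w : g p v w = g p w v := riemannian_sym Hg p v w.
have gB v w y : g p (v - w) y = g p v y - g p w y := linBE (riemannian_linl Hg p y) v w.
have tE X Y Z : smooth_field X -> smooth_field Y ->
    g p (bracket X Y p) (Z p) = g p (nabla X Y p) (Z p) - g p (nabla Y X p) (Z p).
  by move=> sX sY; rewrite -(tor _ _ sX sY) gB.
apply: koszul_algebra (tE A B C sA sB) (tE A C B sA sC) (tE B C A sB sC).
- by rewrite (compat _ _ _ sA sB sC) (sym (B p)).
- by rewrite (compat _ _ _ sB sA sC) (sym (A p)).
- by rewrite (compat _ _ _ sC sA sB) (sym (A p)).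
Qed.

Lemma metric_coord_field_tinv (R : realType) n (M : charted R n) (g : M -> 'rV[R]_n -> 'rV[R]_n -> R)
    i (X : M -> 'rV[R]_n) x v : manifold M -> chart_image i x ->
  g (param i x) (X (param i x)) (tinv i x v) = metric_coord g i x (field_coord X i x) v.
Proof.
move=> HM [p ip <-]; rewrite /metric_coord (field_coordE HM _ ip) (tcoordK HM _ ip).
by rewrite (param_coord HM ip).
Qed.

(** * The metric g_A on lifts *)

Section LiftMetric.
Context {R : realType} {n : nat} (M : charted R n).
Hypothesis HM : manifold M.
Local Notation TM := (tangent_bundle M).
Local Notation crd := (@Defs.coord R n M).
Local Notation par := (@param R n M).
Local Notation crdT := (@Defs.coord R (n + n) TM).
Local Notation parT := (@param R (n + n) TM).
Variables (g : M -> 'rV[R]_n -> 'rV[R]_n -> R)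
  (nabla : (M -> 'rV[R]_n) -> (M -> 'rV[R]_n) -> M -> 'rV[R]_n).
Hypothesis Hg : riemannian_metric g.
Hypothesis LC : levi_civita g nabla.
Variables (a b : R -> R).
Hypotheses (sa : hsmooth a) (sb : hsmooth b).
Variable gA : TM -> 'rV[R]_(n + n) -> 'rV[R]_(n + n) -> R.
Hypothesis HA : is_gA nabla g a b gA.
Let HgA : riemannian_metric gA. Proof. by case: HA. Qed.
Variables (p : M) (u : 'rV[R]_n).
Local Notation j := (pref p).
Local Notation x0 := (crd j p).
Local Notation z := ((p, u) : TM).
Variables (N : set 'rV[R]_n) (E : 'rV[R]_n -> M -> 'rV[R]_n)
  (Gamma : 'rV[R]_n -> 'rV[R]_n -> 'rV[R]_n -> 'rV[R]_n).
Hypothesis lf : local_frame nabla j N E Gamma.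
Hypothesis Nx0 : N x0.
Implicit Types (X Y Z : M -> 'rV[R]_n) (v xi eta : 'rV[R]_n).

Let jp : dom j p := pref_dom HM p.
Let t : R := g p u u / 2.
Local Notation HL v := (hlift_at nabla z v).
Local Notation VL v := (@vlift_at R n M z v).

(** [is_gA] prescribes values on lifts of smooth fields; here and below, [extend] converts them into
    statements on single vectors. *)
Lemma gA_hh v w : gA z (HL v) (HL w) = g p v w.
Proof.
have [sv ev] := extendP HM p v; have [sw ew] := extendP HM p w.
case: HA => _ H _ _; have := H _ _ sv sw z.
by rewrite /hlift /= ev ew.
Qed.

Lemma gA_hv v w : gA z (HL v) (VL w) = 0.
Proof.
have [sv ev] := extendP HM p v; have [sw ew] := extendP HM p w.
case: HA => _ _ H _; have := H _ _ sv sw z.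
by rewrite /hlift /vlift /= ev ew.
Qed.

Lemma gA_vh v w : gA z (VL v) (HL w) = 0.
Proof. by rewrite (riemannian_sym HgA) gA_hv. Qed.

Lemma gA_vv v w : gA z (VL v) (VL w) = a t * g p v w + b t * g p v u * g p w u.
Proof.
have [sv ev] := extendP HM p v; have [sw ew] := extendP HM p w.
case: HA => _ _ _ H; have := H _ _ sv sw z.
by rewrite /vlift /= ev ew.
Qed.

(** Lifts span the tangent space at [z], so such a vector is orthogonal to itself and vanishes by
    positivity. *)
Lemma gA_nondegenerate (xi : 'rV[R]_(n + n)) :
  (forall v, gA z xi (HL v) = 0) -> (forall v, gA z xi (VL v) = 0) -> xi = 0.
Proof.
move=> h0 v0; apply/eqP; apply: contrapT => /negP xi0.
(* The vertical summand compensates the fibre component - Gamma of the horizontal lift. *)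
have xiE : xi = HL (lsubmx xi) + VL (rsubmx xi + Gamma x0 (lsubmx xi) u).
  rewrite (hliftE HM u lf Nx0) (vliftE HM p u) add_row_mx addr0 addrCA addNr addr0.
  by rewrite hsubmxK.
have := HgA; case=> _ _ /(_ z _ xi0) + _.
by rewrite {2}xiE (linDE (riemannian_linr HgA z xi)) h0 v0 addr0 ltxx.
Qed.

Let W := crdT j z.
Let oNT : \forall w \near W, N (lsubmx w) := near_baseT HM u lf Nx0.

Let lsubW : lsubmx W = x0. Proof. exact: lsub_base. Qed.

Let metric_coord_base v w : metric_coord g j x0 v w = g p v w.
Proof.
have := metric_coord_tcoord HM g v w jp.
by rewrite (tcoord_pref HM p v) (tcoord_pref HM p w).
Qed.

Let gBl : \forall w \near W, forall v, lin (metric_coord g j (lsubmx w) ^~ v).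
Proof. by apply: filterS oNT => w Nw v; exact: metric_coord_linl (lf_sub lf Nw). Qed.
Let gBr : \forall w \near W, forall v, lin (metric_coord g j (lsubmx w) v).
Proof. by apply: filterS oNT => w Nw v; exact: metric_coord_linr (lf_sub lf Nw). Qed.
Let gdB v v' : differentiable (fun w : 'rV[R]_(n + n) => metric_coord g j (lsubmx w) v v') W.
Proof.
apply: (@differentiable_comp _ _ _ _ (@lsubmx R 1 n n) (fun y => metric_coord g j y v v')).
  exact: differentiable_lsubmx.
by rewrite lsubW; exact: (differentiable_metric_coord HM Hg lf).
Qed.

Let gDB v v' xi eta :
  'D_(row_mx xi eta) (fun w : 'rV[R]_(n + n) => metric_coord g j (lsubmx w) v v') W
  = g p (Gamma x0 xi v) v' + g p v (Gamma x0 xi v').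
Proof.
apply: etrans (derive_comp_lsubmx (fun y => metric_coord g j y v v') _ _) _.
rewrite lsubW row_mxKl.
by apply: etrans (derive_metric_coord HM Hg LC lf xi v v' Nx0) _; rewrite !metric_coord_base.
Qed.

Lemma differentiable_metric_pairing (F G : 'rV[R]_(n + n) -> 'rV[R]_n) :
  differentiable F W -> differentiable G W ->
  differentiable (fun w => metric_coord g j (lsubmx w) (F w) (G w)) W.
Proof.
move=> dF dG; exact: (@differentiable_bifamily R _ _ _ _
  (fun w : 'rV[R]_(n + n) => metric_coord g j (lsubmx w)) W gBl gBr gdB F G dF dG).
Qed.

(** The derivative of the metric is absorbed by [Gamma] terms, so that each argument is
    differentiated covariantly. *)
Lemma derive_metric_pairing (F G : 'rV[R]_(n + n) -> 'rV[R]_n) xi eta :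
  differentiable F W -> differentiable G W ->
  'D_(row_mx xi eta) (fun w => metric_coord g j (lsubmx w) (F w) (G w)) W
  = g p ('D_(row_mx xi eta) F W + Gamma x0 xi (F W)) (G W)
    + g p (F W) ('D_(row_mx xi eta) G W + Gamma x0 xi (G W)).
Proof.
move=> dF dG; apply: etrans (@derive_bifamily R _ _ _ _
  (fun w : 'rV[R]_(n + n) => metric_coord g j (lsubmx w)) W gBl gBr gdB F G _ dF dG) _.
rewrite gDB lsubW !metric_coord_base.
by rewrite (linDE (riemannian_linl Hg p (G W))) (linDE (riemannian_linr Hg p (F W))); ring.
Qed.

Let fvv Y Z (z' : TM) : R := a (energy g z') * g z'.1 (Y z'.1) (Z z'.1)
  + b (energy g z') * g z'.1 (Y z'.1) z'.2 * g z'.1 (Z z'.1) z'.2.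

Let en w := energy g (parT j w).

Lemma energy_ge0 (z' : TM) : 0 <= energy g z'.
Proof.
case: z' => q v; rewrite /energy /=; apply: divr_ge0 => //.
have [->|v0] := eqVneq v 0; first by rewrite (lin0 (riemannian_linl Hg q 0)).
by case: Hg => _ _ pos _; rewrite ltW// pos.
Qed.

Let enW : en W = t.
Proof. by rewrite /en (@parT_coord _ _ _ HM j z jp). Qed.

Let rsubW : rsubmx W = u. Proof. exact: rsub_base. Qed.

(** [eta + Gamma x0 xi u] is the vertical part of the vector [(xi, eta)]: zero for a horizontal
    lift, X for the vertical lift of X. *)
Let is_derive_en xi eta :
  is_derive W (row_mx xi eta) en (g p (eta + Gamma x0 xi u) u).
Proof.
pose h (w : 'rV[R]_(n + n)) := metric_coord g j (lsubmx w) (rsubmx w) (rsubmx w).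
have drW : differentiable (@rsubmx R 1 n n) W := differentiable_rsub_base p u.
have dh : differentiable h W := differentiable_metric_pairing drW drW.
have hE : is_derive W (row_mx xi eta) h (2 * g p (eta + Gamma x0 xi u) u).
  split; first exact: diff_derivable.
  apply: etrans (derive_metric_pairing xi eta drW drW) _.
  rewrite (derive_rsubmx W (row_mx xi eta)) row_mxKr rsubW (riemannian_sym Hg p u).
  by rewrite mulr_natl mulr2n.
have H := is_deriveZ 2^-1 hE.
have ne : \forall w \near W, (2^-1 \*: h) w = en w.
  by apply: filterS oNT => w Nw; rewrite /en /energy parTE /= /h /metric_coord mulrC.
apply: (near_eq_is_derive ne); apply: (is_derive_eq H).
by rewrite -[_ *: _]/(_ * _) mulrA mulVf ?mul1r.
Qed.

(** One formula for both kinds of lift: a horizontal direction has [c = 0], while a vertical one has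
    [xi = 0] and hence no covariant terms. *)
Lemma derive_fvv (A : TM -> 'rV[R]_(n + n)) Y Z xi eta :
  smooth_field Y -> smooth_field Z -> A z = row_mx xi eta ->
  let c := eta + Gamma x0 xi u in
  let nY := 'D_xi (field_coord Y j) x0 + Gamma x0 xi (Y p) in
  let nZ := 'D_xi (field_coord Z j) x0 + Gamma x0 xi (Z p) in
  field_deriv A (fvv Y Z) z =
    hderive a t * g p c u * g p (Y p) (Z p)
    + a t * (g p nY (Z p) + g p (Y p) nZ)
    + hderive b t * g p c u * g p (Y p) u * g p (Z p) u
    + b t * (g p nY u + g p (Y p) c) * g p (Z p) u
    + b t * g p (Y p) u * (g p nZ u + g p (Z p) c).
Proof.
move=> sY sZ Az c nY nZ.
pose f X (w : 'rV[R]_(n + n)) := field_coord X j (lsubmx w).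
have df X (sX : smooth_field X) : differentiable (f X) W := differentiable_lsub_field HM p u sX.
have fW X : f X W = X p by exact: field_coord_base.
have Df X : 'D_(row_mx xi eta) (f X) W = 'D_xi (field_coord X j) x0.
  exact: derive_lsub_field.
have drW : differentiable (@rsubmx R 1 n n) W := differentiable_rsub_base p u.
have Dr : 'D_(row_mx xi eta) (@rsubmx R 1 n n) W = eta.
  by apply: etrans (derive_rsubmx _ _) _; rewrite row_mxKr.
pose r w := metric_coord g j (lsubmx w) (f Y w) (f Z w).
pose q X w := metric_coord g j (lsubmx w) (f X w) (rsubmx w).
have Hr : is_derive W (row_mx xi eta) r (g p nY (Z p) + g p (Y p) nZ).
  split; first exact/diff_derivable/(differentiable_metric_pairing (df Y sY) (df Z sZ)).
  apply: etrans (derive_metric_pairing xi eta (df Y sY) (df Z sZ)) _.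
  by rewrite !Df !fW.
have Hq X (sX : smooth_field X) : is_derive W (row_mx xi eta) (q X)
    (g p ('D_xi (field_coord X j) x0 + Gamma x0 xi (X p)) u + g p (X p) c).
  split; first exact/diff_derivable/(differentiable_metric_pairing (df X sX) drW).
  apply: etrans (derive_metric_pairing xi eta (df X sX) drW) _.
  by rewrite Df fW Dr rsubW.
have ca : cvg (incr_ratio a (en W) h @[h --> incr_filter (en W)]).
  exact: (@sa 0%N _ (energy_ge0 _)).
have cb : cvg (incr_ratio b (en W) h @[h --> incr_filter (en W)]).
  exact: (@sb 0%N _ (energy_ge0 _)).
(* The one-sided chain rule is required because the energy may be 0, namely at the zero vector. *)
have Ha := @derive_halfline R _ a en W _ _ (fun w => energy_ge0 (parT j w)) ca (is_derive_en xi eta).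
have Hb := @derive_halfline R _ b en W _ _ (fun w => energy_ge0 (parT j w)) cb (is_derive_en xi eta).
rewrite enW in Ha Hb.
have ne : \forall w \near W, (fvv Y Z \o parT j) w
    = a (en w) * r w + b (en w) * q Y w * q Z w.
  apply: filterS oNT => w Nw; have iw := lf_sub lf Nw.
  have e1 := metric_coord_field HM g Y Z iw.
  have e2 := metric_coord_field_tinv g Y (rsubmx w) HM iw.
  have e3 := metric_coord_field_tinv g Z (rsubmx w) HM iw.
  by rewrite /r /q /f -e1 -e2 -e3.
have -> : field_deriv A (fvv Y Z) z = 'D_(row_mx xi eta) (fvv Y Z \o parT j) W by rewrite -Az.
rewrite (near_eq_derive _ ne).
have rW : r W = g p (Y p) (Z p) by rewrite /r lsubW metric_coord_base !fW.
have qW X : q X W = g p (X p) u by rewrite /q lsubW metric_coord_base fW rsubW.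
have [_ D1] := is_deriveD (is_deriveM Ha Hr) (is_deriveM (is_deriveM Hb (Hq Y sY)) (Hq Z sZ)).
apply: etrans D1 _; rewrite !fctE enW rW !qW.
exact: product_rule_algebra.
Qed.

End LiftMetric.
Local Opaque derive field_coord tcoord tinv transition bracket smooth_field smooth_fun field_deriv.

(** Here [s], [t'], [uu] are a(t), b(t), g(u,u) = 2t, and [xu], [yz] and so on are products under g.
    The factor [s + uu * t'] comes from g_A(u^V, Z^V) = (a + 2tb) g(Z, u), whence the denominators
    of M and N; the final zeros are the brackets of vertical lifts. *)
Lemma lift_algebra (R : realType) (s t' Lc m nn xu yu zu xy xz yz uu : R) (a' b' : R) :
  s != 0 -> s + uu * t' != 0 ->
  Lc = a' / (2 * s) -> m = (2 * t' - a') / (2 * (s + uu * t')) ->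
  nn = (s * b' - 2 * a' * t') / (2 * s * (s + uu * t')) ->
  2 * (Lc * (xu * (s * yz + t' * yu * zu) + yu * (s * xz + t' * xu * zu))
       + (m * xy) * (s * zu + t' * uu * zu) + (nn * xu * yu) * (s * zu + t' * uu * zu)) =
  (a' * xu * yz + b' * xu * yu * zu + t' * xy * zu + t' * yu * xz)
  + (a' * yu * xz + b' * yu * xu * zu + t' * xy * zu + t' * xu * yz)
  - (a' * zu * xy + b' * zu * xu * yu + t' * xz * yu + t' * xu * yz) + 0 - 0 - 0.
Proof. by move=> s0 d0 -> -> ->; field; rewrite d0 s0. Qed.

Lemma koszul_sum_congr (R : realType) (d1 d2 d3 k1 k2 k3 d1' d2' d3' k1' k2' k3' : R) :
  d1 = d1' -> d2 = d2' -> d3 = d3' -> k1 = k1' -> k2 = k2' -> k3 = k3' ->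
  d1 + d2 - d3 + k1 - k2 - k3 = d1' + d2' - d3' + k1' - k2' - k3'.
Proof. by move=> -> -> -> -> -> ->. Qed.

(** * The covariant derivatives of lifts *)

Section LeviCivitaOfLifts.
Context {R : realType} {n : nat} (M : charted R n).
Hypothesis HM : manifold M.
Local Notation TM := (tangent_bundle M).
Local Notation crd := (@Defs.coord R n M).
Local Notation par := (@param R n M).
Local Notation crdT := (@Defs.coord R (n + n) TM).
Local Notation parT := (@param R (n + n) TM).
Variables (g : M -> 'rV[R]_n -> 'rV[R]_n -> R)
  (nabla : (M -> 'rV[R]_n) -> (M -> 'rV[R]_n) -> M -> 'rV[R]_n).
Hypothesis Hg : riemannian_metric g.
Hypothesis LC : levi_civita g nabla.
Let Cn : connection nabla. Proof. by case: LC. Qed.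
Variables (a b : R -> R).
Hypotheses (sa : hsmooth a) (sb : hsmooth b).
Hypothesis a_gt0 : forall t, 0 <= t -> 0 < a t.
Hypothesis b_ge0 : forall t, 0 <= t -> 0 <= b t.
Variable gA : TM -> 'rV[R]_(n + n) -> 'rV[R]_(n + n) -> R.
Hypothesis HA : is_gA nabla g a b gA.
Let HgA : riemannian_metric gA. Proof. by case: HA. Qed.
Variable nablaA : (TM -> 'rV[R]_(n + n)) -> (TM -> 'rV[R]_(n + n)) -> TM -> 'rV[R]_(n + n).
Hypothesis LCA : levi_civita gA nablaA.
Variables (p : M) (u : 'rV[R]_n).
Local Notation j := (pref p).
Local Notation x0 := (crd j p).
Local Notation z := ((p, u) : TM).
Variables (N : set 'rV[R]_n) (E : 'rV[R]_n -> M -> 'rV[R]_n)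
  (Gamma : 'rV[R]_n -> 'rV[R]_n -> 'rV[R]_n -> 'rV[R]_n).
Hypothesis lf : local_frame nabla j N E Gamma.
Hypothesis Nx0 : N x0.
Implicit Types (X Y Z : M -> 'rV[R]_n) (v w xi eta : 'rV[R]_n) (A B C : TM -> 'rV[R]_(n + n)).

Let t : R := g p u u / 2.
Local Notation HL v := (hlift_at nabla z v).
Local Notation VL v := (@vlift_at R n M z v).
Let hh := gA_hh HM HA p u.
Let hv := gA_hv HM HA p u.
Let vh := gA_vh HM HA p u.
Let gvv v w := a t * g p v w + b t * g p v u * g p w u.
Let vv v w : gA z (VL v) (VL w) = gvv v w := gA_vv HM HA p u v w.
Let gsym v w : g p v w = g p w v := riemannian_sym Hg p v w.
Let sH X : smooth_field X -> @smooth_field _ _ TM (hlift nabla X) := fun sX => smooth_hlift HM Cn sX.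
Let sV X : smooth_field X -> @smooth_field _ _ TM (vlift X) := fun sX => smooth_vlift HM sX.

Let gvv_sym v w : gvv v w = gvv w v.
Proof. by rewrite /gvv (gsym v w) mulrAC. Qed.

(** The tests are phrased with fields and keep the factor 2, which is the shape of Koszul's
    formula. *)
Lemma nablaA_eq A B (T : 'rV[R]_(n + n)) :
  (forall Z, smooth_field Z -> 2 * gA z (nablaA A B z) (hlift nabla Z z) = 2 * gA z T (HL (Z p))) ->
  (forall Z, smooth_field Z -> 2 * gA z (nablaA A B z) (vlift Z z) = 2 * gA z T (VL (Z p))) ->
  nablaA A B z = T.
Proof.
move=> eH eV; apply/eqP; rewrite -subr_eq0; apply/eqP.
have two (x y : R) : 2 * x = 2 * y -> x = y by apply: mulfI; rewrite pnatr_eq0.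
apply: (gA_nondegenerate (u := u) HM HA lf Nx0) => v; have [sv ev] := extendP HM p v.
- rewrite (linBE (riemannian_linl HgA z (HL v))); apply/eqP; rewrite subr_eq0; apply/eqP.
  by have := two _ _ (eH _ sv); rewrite /hlift /= ev.
- rewrite (linBE (riemannian_linl HgA z (VL v))); apply/eqP; rewrite subr_eq0; apply/eqP.
  by have := two _ _ (eV _ sv); rewrite /vlift /= ev.
Qed.

Let fHH Y Z : smooth_field Y -> smooth_field Z ->
  (fun z' => gA z' (hlift nabla Y z') (hlift nabla Z z')) = (fun z' : TM => g z'.1 (Y z'.1) (Z z'.1)).
Proof. by move=> sY sZ; apply/funext => z'; case: HA => _ -> . Qed.
Let fHV Y Z : smooth_field Y -> smooth_field Z ->
  (fun z' => gA z' (hlift nabla Y z') (vlift Z z')) = (fun=> 0).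
Proof. by move=> sY sZ; apply/funext => z'; case: HA => _ _ -> . Qed.
Let fVH Y Z : smooth_field Y -> smooth_field Z ->
  (fun z' => gA z' (vlift Y z') (hlift nabla Z z')) = (fun=> 0).
Proof.
by move=> sY sZ; rewrite -(fHV sZ sY); apply/funext => z'; exact: riemannian_sym.
Qed.
Let fVV Y Z : smooth_field Y -> smooth_field Z ->
  (fun z' => gA z' (vlift Y z') (vlift Z z')) =
  (fun z' : TM => a (energy g z') * g z'.1 (Y z'.1) (Z z'.1)
    + b (energy g z') * g z'.1 (Y z'.1) z'.2 * g z'.1 (Z z'.1) z'.2).
Proof. by move=> sY sZ; apply/funext => z'; case: HA => _ _ _ -> . Qed.

Let hX X : hlift nabla X z = row_mx (X p) (- Gamma x0 (X p) u) := hliftE HM u lf Nx0 (X p).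
Let vX X : vlift X z = row_mx 0 (X p) := vliftE HM p u (X p).

Local Transparent field_deriv.
Let field_deriv_base A (h : M -> R) xi eta : A z = row_mx xi eta ->
  field_deriv A (fun z' : TM => h z'.1) z = 'D_xi (h \o par j) x0.
Proof.
move=> Az; apply: etrans (derive_comp_lsubmx (h \o par j) _ _) _.
by rewrite (lsub_base HM p u) Az row_mxKl.
Qed.

Let field_deriv0 A : field_deriv A (fun=> 0) z = 0.
Proof. exact: derive_cst. Qed.
Local Opaque field_deriv.

Let dHHH X Y Z : smooth_field Y -> smooth_field Z ->
  field_deriv (hlift nabla X) (fun z' => gA z' (hlift nabla Y z') (hlift nabla Z z')) z
  = field_deriv X (fun q => g q (Y q) (Z q)) p.
Proof.
by move=> sY sZ; rewrite (fHH sY sZ); exact: field_deriv_base (hX X).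
Qed.

Let dVHH X Y Z : smooth_field Y -> smooth_field Z ->
  field_deriv (vlift X) (fun z' => gA z' (hlift nabla Y z') (hlift nabla Z z')) z = 0.
Proof.
move=> sY sZ; rewrite (fHH sY sZ).
apply: etrans (field_deriv_base (fun q => g q (Y q) (Z q)) (vX X)) _; exact: derive0.
Qed.

Let dHV A Y Z : smooth_field Y -> smooth_field Z ->
  field_deriv A (fun z' => gA z' (hlift nabla Y z') (vlift Z z')) z = 0.
Proof. by move=> sY sZ; rewrite (fHV sY sZ); exact: field_deriv0. Qed.

Let dVH A Y Z : smooth_field Y -> smooth_field Z ->
  field_deriv A (fun z' => gA z' (vlift Y z') (hlift nabla Z z')) z = 0.
Proof. by move=> sY sZ; rewrite (fVH sY sZ); exact: field_deriv0. Qed.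

Let g0l v : g p 0 v = 0. Proof. exact: lin0 (riemannian_linl Hg p v). Qed.
Let g0r v : g p v 0 = 0. Proof. exact: lin0 (riemannian_linr Hg p v). Qed.

Let dfvv A Y Z xi eta c nY nZ :
  smooth_field Y -> smooth_field Z -> A z = row_mx xi eta ->
  eta + Gamma x0 xi u = c -> 'D_xi (field_coord Y j) x0 + Gamma x0 xi (Y p) = nY ->
  'D_xi (field_coord Z j) x0 + Gamma x0 xi (Z p) = nZ ->
  field_deriv A (fun z' => gA z' (vlift Y z') (vlift Z z')) z =
    hderive a t * g p c u * g p (Y p) (Z p)
    + a t * (g p nY (Z p) + g p (Y p) nZ)
    + hderive b t * g p c u * g p (Y p) u * g p (Z p) u
    + b t * (g p nY u + g p (Y p) c) * g p (Z p) u
    + b t * g p (Y p) u * (g p nZ u + g p (Z p) c).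
Proof.
move=> sY sZ Az <- <- <-; rewrite (fVV sY sZ).
exact: (derive_fvv HM Hg LC sa sb lf Nx0 sY sZ Az).
Qed.

Let dHVV X Y Z : smooth_field X -> smooth_field Y -> smooth_field Z ->
  field_deriv (hlift nabla X) (fun z' => gA z' (vlift Y z') (vlift Z z')) z
  = gvv (nabla X Y p) (Z p) + gvv (Y p) (nabla X Z p).
Proof.
move=> sX sY sZ.
(* [addNr] says that the vertical part of a horizontal lift vanishes, which removes the derivatives
   of [a] and [b]. *)
apply: etrans (dfvv sY sZ (hX X) (addNr _) (esym (nabla_base HM lf Nx0 sX sY))
  (esym (nabla_base HM lf Nx0 sX sZ))) _.
by rewrite g0l !g0r /gvv; ring.
Qed.

Let dVVV X Y Z : smooth_field Y -> smooth_field Z ->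
  field_deriv (vlift X) (fun z' => gA z' (vlift Y z') (vlift Z z')) z
  = hderive a t * g p (X p) u * g p (Y p) (Z p)
    + hderive b t * g p (X p) u * g p (Y p) u * g p (Z p) u
    + b t * g p (X p) (Y p) * g p (Z p) u + b t * g p (Y p) u * g p (X p) (Z p).
Proof.
move=> sY sZ.
have G0 v : Gamma x0 0 v = 0 by exact: lin0 (lf_linl lf Nx0 v).
have D0 W : 'D_0 (field_coord W j) x0 + Gamma x0 0 (W p) = 0.
  by apply: etrans (congr2 +%R (derive0 _ _) (G0 _)) _; rewrite addr0.
have E0 : X p + Gamma x0 0 u = X p by rewrite G0 addr0.
apply: etrans (dfvv sY sZ (vX X) E0 (D0 Y) (D0 Z)) _.
by rewrite !g0l !g0r (gsym (Y p) (X p)) (gsym (Z p) (X p)); ring.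
Qed.

Let bvv X Y : smooth_field X -> smooth_field Y ->
  @bracket _ _ TM (vlift X) (vlift Y) z = 0 := fun sX sY => bracket_vv HM u lf Nx0 sX sY.
Let bhv X Y : smooth_field X -> smooth_field Y ->
  @bracket _ _ TM (hlift nabla X) (vlift Y) z = VL (nabla X Y p) := fun sX sY => bracket_hv HM u lf Nx0 sX sY.
Let bhh X Y : smooth_field X -> smooth_field Y ->
  @bracket _ _ TM (hlift nabla X) (hlift nabla Y) z
  = HL (bracket X Y p) - VL (curv nabla p (X p) (Y p) u) := fun sX sY => bracket_hh HM LC u lf Nx0 sX sY.

Let bracketN A B : bracket A B z = - bracket B A z.
Proof. by rewrite !bracketTE opprB. Qed.

Let bvh X Y : smooth_field X -> smooth_field Y ->
  @bracket _ _ TM (vlift X) (hlift nabla Y) z = - VL (nabla Y X p).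
Proof. by move=> sX sY; rewrite bracketN (bhv sY sX). Qed.

Let gAB (x1 x2 y : 'rV[R]_(n + n)) : gA z (x1 - x2) y = gA z x1 y - gA z x2 y
  := linBE (riemannian_linl HgA z y) x1 x2.
Let gAD (x1 x2 y : 'rV[R]_(n + n)) : gA z (x1 + x2) y = gA z x1 y + gA z x2 y
  := linDE (riemannian_linl HgA z y) x1 x2.
Let gAZ (c : R) (x1 y : 'rV[R]_(n + n)) : gA z (c *: x1) y = c * gA z x1 y
  := linZE (riemannian_linl HgA z y) c x1.
Let gAN (x1 y : 'rV[R]_(n + n)) : gA z (- x1) y = - gA z x1 y
  := linNE (riemannian_linl HgA z y) x1.
Let gA0 (y : 'rV[R]_(n + n)) : gA z 0 y = 0 := lin0 (riemannian_linl HgA z y).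

(** Skew symmetry with both arguments equal to [u]. It removes the [b] term of g_A((R_XZ u)^V, Y^V),
    which is why only [a] appears in the mixed formulas. *)
Let curv_uu v w : g p (curv nabla p v w u) u = 0.
Proof.
have := curv_coord_skew34 HM Hg LC lf v w u u Nx0.
rewrite -(curv_base HM LC u lf Nx0) (metric_coord_sym Hg j x0 u).
have -> : metric_coord g j x0 (curv nabla p v w u) u = g p (curv nabla p v w u) u.
  have := metric_coord_tcoord HM g (curv nabla p v w u) u (pref_dom HM p).
  by rewrite !(tcoord_pref HM p).
by move=> H; lra.
Qed.

Let curv_pair v w y : g p (curv nabla p v w u) y = g p (curv nabla p u y v) w.
Proof.
have gb x1 x2 : metric_coord g j x0 x1 x2 = g p x1 x2.
  have := metric_coord_tcoord HM g x1 x2 (pref_dom HM p).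
  by rewrite !(tcoord_pref HM p).
have := curv_coord_pair HM Hg LC lf v w u y Nx0.
by rewrite -(curv_base HM LC u lf Nx0) -(curv_base HM LC v lf Nx0) !gb.
Qed.

Let kHHH X Y Z : smooth_field X -> smooth_field Y ->
  gA z (bracket (hlift nabla X) (hlift nabla Y) z) (hlift nabla Z z) = g p (bracket X Y p) (Z p).
Proof.
move=> sX sY; rewrite (bhh sX sY) gAB; apply: etrans (congr2 (fun r s => r - s) (hh _ _) (vh _ _)) _.
by rewrite subr0.
Qed.
Let kHHV X Y Z : smooth_field X -> smooth_field Y ->
  gA z (bracket (hlift nabla X) (hlift nabla Y) z) (vlift Z z)
  = - gvv (curv nabla p (X p) (Y p) u) (Z p).
Proof.
move=> sX sY; rewrite (bhh sX sY) gAB; apply: etrans (congr2 (fun r s => r - s) (hv _ _) (vv _ _)) _.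
by rewrite sub0r.
Qed.
Let kHVH X Y Z : smooth_field X -> smooth_field Y ->
  gA z (bracket (hlift nabla X) (vlift Y) z) (hlift nabla Z z) = 0.
Proof. by move=> sX sY; rewrite (bhv sX sY); exact: vh. Qed.
Let kHVV X Y Z : smooth_field X -> smooth_field Y ->
  gA z (bracket (hlift nabla X) (vlift Y) z) (vlift Z z) = gvv (nabla X Y p) (Z p).
Proof. by move=> sX sY; rewrite (bhv sX sY); exact: vv. Qed.
Let kVHH X Y Z : smooth_field X -> smooth_field Y ->
  gA z (bracket (vlift X) (hlift nabla Y) z) (hlift nabla Z z) = 0.
Proof.
by move=> sX sY; rewrite (bvh sX sY) gAN; apply: etrans (congr1 -%R (vh _ _)) _; rewrite oppr0.
Qed.
Let kVHV X Y Z : smooth_field X -> smooth_field Y ->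
  gA z (bracket (vlift X) (hlift nabla Y) z) (vlift Z z) = - gvv (nabla Y X p) (Z p).
Proof.
by move=> sX sY; rewrite (bvh sX sY) gAN; exact: (congr1 -%R (vv _ _)).
Qed.
Let kVV X Y (C : 'rV[R]_(n + n)) : smooth_field X -> smooth_field Y ->
  gA z (bracket (vlift X) (vlift Y) z) C = 0.
Proof. by move=> sX sY; rewrite (bvv sX sY) gA0. Qed.

Lemma nablaA_hh X Y : smooth_field X -> smooth_field Y ->
  nablaA (hlift nabla X) (hlift nabla Y) z
  = HL (nabla X Y p) - 2^-1 *: VL (curv nabla p (X p) (Y p) u).
Proof.
move=> sX sY; apply: nablaA_eq => Z sZ.
- apply: etrans (koszul z HgA LCA (sH sX) (sH sY) (sH sZ)) _.
  apply: etrans (koszul_sum_congr (dHHH X sY sZ) (dHHH Y sX sZ) (dHHH Z sX sY)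
    (kHHH Z sX sY) (kHHH Y sX sZ) (kHHH X sY sZ)) _.
  rewrite gAB gAZ hh vh mulr0 subr0.
  exact: esym (koszul p Hg LC sX sY sZ).
(* Against a vertical lift only the vertical part - R_XY u of the bracket survives; the factor 2 in
   Koszul's formula halves it. *)
- apply: etrans (koszul z HgA LCA (sH sX) (sH sY) (sV sZ)) _.
  apply: etrans (koszul_sum_congr (dHV _ sY sZ) (dHV _ sX sZ) (dVHH Z sX sY)
    (kHHV Z sX sY) (kHVH Y sX sZ) (kHVH X sY sZ)) _.
  by rewrite gAB gAZ hv vv; field.
Qed.

Lemma nablaA_hv X Y : smooth_field X -> smooth_field Y ->
  nablaA (hlift nabla X) (vlift Y) z
  = VL (nabla X Y p) + (a t / 2) *: HL (curv nabla p u (Y p) (X p)).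
Proof.
move=> sX sY; apply: nablaA_eq => Z sZ.
- apply: etrans (koszul z HgA LCA (sH sX) (sV sY) (sH sZ)) _.
  apply: etrans (koszul_sum_congr (dVH _ sY sZ) (dVHH Y sX sZ) (dHV _ sX sY)
    (kHVH Z sX sY) (kHHV Y sX sZ) (kVHH X sY sZ)) _.
  rewrite gAD gAZ hh vh /gvv curv_uu curv_pair.
  by field.
(* The derivative along X^H gives one term for Y and one for Z; the brackets double the first and
   cancel the second. *)
- apply: etrans (koszul z HgA LCA (sH sX) (sV sY) (sV sZ)) _.
  apply: etrans (koszul_sum_congr (dHVV sX sY sZ) (dHV _ sX sZ) (dHV _ sX sY)
    (kHVV Z sX sY) (kHVV Y sX sZ) (kVV _ sY sZ)) _.
  rewrite gAD gAZ vv hv (gvv_sym (Y p)).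
  by ring.
Qed.

(** Vanishing torsion reduces this to the previous case: the bracket of X^V and Y^H is minus the
    vertical lift of nabla_Y X and cancels the vertical part. *)
Lemma nablaA_vh X Y : smooth_field X -> smooth_field Y ->
  nablaA (vlift X) (hlift nabla Y) z = (a t / 2) *: HL (curv nabla p u (X p) (Y p)).
Proof.
move=> sX sY; have [_ tor _] := LCA.
have := tor _ _ (sV sX) (sH sY) z; rewrite (bvh sX sY) (nablaA_hv sY sX).
by move=> /eqP; rewrite subr_eq addrA addNr add0r => /eqP.
Qed.

Lemma nablaA_vv X Y (Lc m nn : R) : smooth_field X -> smooth_field Y ->
  Lc = hderive a t / (2 * a t) ->
  m = (2 * b t - hderive a t) / (2 * (a t + 2 * t * b t)) ->
  nn = (a t * hderive b t - 2 * hderive a t * b t) / (2 * a t * (a t + 2 * t * b t)) ->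
  nablaA (vlift X) (vlift Y) z =
  Lc *: (g p (X p) u *: VL (Y p) + g p (Y p) u *: VL (X p))
  + (m * g p (X p) (Y p)) *: VL u + (nn * g p (X p) u * g p (Y p) u) *: VL u.
Proof.
move=> sX sY eL em en.
have t0 : 0 <= t := energy_ge0 Hg (p, u).
have at0 := a_gt0 t0.
(* Nonnegativity of [b] and of t keeps the denominators of M and N away from 0. *)
have d0 : 0 < a t + 2 * t * b t.
  by rewrite ltr_pwDl// mulr_ge0 ?b_ge0// mulr_ge0.
have guu : g p u u = 2 * t by rewrite /t mulrC divfK.
have T y r1 r2 r3 : gA z (VL (Y p)) y = r1 -> gA z (VL (X p)) y = r2 -> gA z (VL u) y = r3 ->
  gA z (Lc *: (g p (X p) u *: VL (Y p) + g p (Y p) u *: VL (X p))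
  + (m * g p (X p) (Y p)) *: VL u + (nn * g p (X p) u * g p (Y p) u) *: VL u) y
  = Lc * (g p (X p) u * r1 + g p (Y p) u * r2)
  + (m * g p (X p) (Y p)) * r3 + (nn * g p (X p) u * g p (Y p) u) * r3.
  by move=> <- <- <-; rewrite gAD gAD gAZ gAD; congr (_ * (_ + _) + _ + _); exact: gAZ.
apply: nablaA_eq => Z sZ.
(* The derivative of g_A(X^V, Y^V) along Z^H is exactly compensated by the two mixed brackets, so
   there is no horizontal part. *)
- apply: etrans (koszul z HgA LCA (sV sX) (sV sY) (sH sZ)) _.
  apply: etrans (koszul_sum_congr (dVH _ sY sZ) (dVH _ sX sZ) (dHVV sZ sX sY)
    (kVV _ sX sY) (kVHV Y sX sZ) (kVHV X sY sZ)) _.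
  rewrite (T _ _ _ _ (vh _ _) (vh _ _) (vh _ _)) (gvv_sym (X p)).
  by ring.
- apply: etrans (koszul z HgA LCA (sV sX) (sV sY) (sV sZ)) _.
  apply: etrans (koszul_sum_congr (dVVV X sY sZ) (dVVV Y sX sZ) (dVVV Z sX sY)
    (kVV _ sX sY) (kVV _ sX sZ) (kVV _ sY sZ)) _.
  apply: etrans _ (esym (congr1 (fun r => 2 * r) (T _ _ _ _ (vv _ _) (vv _ _) (vv _ _)))).
  rewrite /gvv (gsym (Y p) (X p)) (gsym (Z p) (X p)) (gsym (Z p) (Y p)) (gsym u (Z p)) guu.
  apply: esym; apply: lift_algebra eL em en; first by rewrite gt_eqF.
  by rewrite gt_eqF.
Qed.

End LeviCivitaOfLifts.

Theorem proposition2p11 (R : realType) (n : nat) (M : charted R n)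
  (g : M -> 'rV[R]_n -> 'rV[R]_n -> R)
  (nabla : (M -> 'rV[R]_n) -> (M -> 'rV[R]_n) -> M -> 'rV[R]_n)
  (a b : R -> R)
  (gA : tangent_bundle M -> 'rV[R]_(n + n) -> 'rV[R]_(n + n) -> R)
  (nablaA : (tangent_bundle M -> 'rV[R]_(n + n)) ->
            (tangent_bundle M -> 'rV[R]_(n + n)) ->
            tangent_bundle M -> 'rV[R]_(n + n)) :
  manifold M ->
  riemannian_metric g ->
  levi_civita g nabla ->
  hsmooth a -> hsmooth b ->
  (forall t, 0 <= t -> 0 < a t) -> (forall t, 0 <= t -> 0 <= b t) ->
  is_gA nabla g a b gA ->
  levi_civita gA nablaA ->
  forall X Y : M -> 'rV[R]_n, smooth_field X -> smooth_field Y ->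
  forall (p : M) (u : 'rV[R]_n),
  let z : tangent_bundle M := (p, u) in
  let t := g p u u / 2 in
  let L := hderive a t / (2 * a t) in
  let MM := (2 * b t - hderive a t) / (2 * (a t + 2 * t * b t)) in
  let N := (a t * hderive b t - 2 * hderive a t * b t)
           / (2 * a t * (a t + 2 * t * b t)) in
  [/\ nablaA (hlift nabla X) (hlift nabla Y) z
      = hlift nabla (nabla X Y) z
        - 2^-1 *: vlift_at z (curv nabla p (X p) (Y p) u),
      nablaA (hlift nabla X) (vlift Y) z
      = vlift (nabla X Y) z
        + (a t / 2) *: hlift_at nabla z (curv nabla p u (Y p) (X p)),
      nablaA (vlift X) (hlift nabla Y) z
      = (a t / 2) *: hlift_at nabla z (curv nabla p u (X p) (Y p))
    & nablaA (vlift X) (vlift Y) z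
      = L *: (g p (X p) u *: vlift Y z + g p (Y p) u *: vlift X z)
        + (MM * g p (X p) (Y p)) *: vlift_at z u
        + (N * g p (X p) u * g p (Y p) u) *: vlift_at z u].
Proof.
move=> HM Hg LC sa sb a_gt0 b_ge0 HA LCA X Y sX sY p u z t L MM N.
have Cn : connection nabla by case: LC.
have [U [E [Gamma [Ux lf]]]] := local_frame_exists HM Cn (dom_image (pref_dom HM p)).
split.
- exact: (nablaA_hh HM Hg LC HA LCA u lf Ux sX sY).
- exact: (nablaA_hv HM Hg LC sa sb HA LCA u lf Ux sX sY).
- exact: (nablaA_vh HM Hg LC sa sb HA LCA u lf Ux sX sY).
- exact: (nablaA_vv HM Hg LC sa sb a_gt0 b_ge0 HA LCA lf Ux sX sY).
Qed.
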